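(* For $\lambda\in\mathbb{C}$, let $M^{2,\lambda}$ be the $n$-dimensional complex Leibniz algebra with basis $e_1,\dots,e_n$ and products $[e_i,e_1]=e_{i+1}$ for $1\le i\le n-3$, $[e_{n-1},e_1]=e_n$, $[e_1,e_{n-1}]=\lambda e_n$ (all other products zero). Every $(n+2)$-dimensional complex solvable Leibniz algebra whose nilradical is $M^{2,\lambda}$ for some $\lambda\in\mathbb{C}$ is isomorphic to one of the following two non-isomorphic algebras with basis $e_1,\dots,e_n,x_1,x_2$ (products not listed are zero): $R(M^{2,0},2)$: the products of $M^{2,0}$ among $e_1,\dots,e_n$, and $[e_i,x_1]=ie_i$ for $1\le i\le n-2$; $[e_n,x_1]=e_n$; $[x_1,e_1]=-e_1$; $[e_{n-1},x_2]=e_{n-1}$; $[e_n,x_2]=e_n$. $R(M^{2,-1},2)$: the products of $M^{2,-1}$ among $e_1,\dots,e_n$, and $[e_i,x_1]=ie_i$ for $1\le i\le n-2$; $[x_1,e_1]=-e_1$; $[e_n,x_1]=e_n$; $[x_1,e_n]=-e_n$; $[e_{n-1},x_2]=e_{n-1}$; $[x_2,e_{n-1}]=-e_{n-1}$; $[e_n,x_2]=e_n$; $[x_2,e_n]=-e_n$.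
   Context: All algebras are finite-dimensional over $\mathbb{C}$. A (right) Leibniz algebra is a vector space with a bilinear bracket satisfying $[x,[y,z]]=[[x,y],z]-[[x,z],y]$. With $L^{[1]}=L$, $L^{[s+1]}=[L^{[s]},L^{[s]}]$ and $L^1=L$, $L^{k+1}=[L^k,L]$, the algebra $L$ is solvable if some $L^{[m]}=0$ and nilpotent if some $L^k=0$. The nilradical is the maximal nilpotent ideal. *)

(* Defs.v *)
From HB Require Import structures.
From mathcomp Require Import all_boot all_order all_algebra.
From mathcomp Require Import complex reals.

Set Implicit Arguments.
Unset Strict Implicit.
Unset Printing Implicit Defensive.

Import GRing.Theory.
Local Open Scope ring_scope.

Section Leibniz.

Variables (F : fieldType) (L : vectType F) (br : {bilinear L -> L -> L}).

Definition leibniz_identity : Prop :=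
  forall x y z : L, br x (br y z) = br (br x y) z - br (br x z) y.

(* [U, V] is the span of all brackets [u, v]; by bilinearity, bases suffice. *)
Definition brv (U V : {vspace L}) : {vspace L} :=
  <<[seq br u v | u <- vbasis U, v <- vbasis V]>>%VS.

(* Both series are indexed from 0: derived_series U s is U^[s+1] and
   lower_central_series U k is U^(k+1). *)
Definition derived_series (U : {vspace L}) (s : nat) : {vspace L} :=
  iter s (fun V => brv V V) U.

Definition lower_central_series (U : {vspace L}) (k : nat) : {vspace L} :=
  iter k (fun V => brv V U) U.

Definition solvable_algebra : Prop :=
  exists m : nat, derived_series fullv m = 0%VS.

Definition ideal (I : {vspace L}) : Prop :=
  (brv I fullv <= I)%VS /\ (brv fullv I <= I)%VS.

Definition nilpotent_ideal (I : {vspace L}) : Prop :=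
  ideal I /\ exists k : nat, lower_central_series I k = 0%VS.

Definition nilradical (N : {vspace L}) : Prop :=
  nilpotent_ideal N /\
  forall I : {vspace L}, nilpotent_ideal I -> (I <= N)%VS.

End Leibniz.

(* U (with the bracket of L) is isomorphic to the algebra A: there is an
   injective linear map A -> L with image U that preserves brackets. *)
Definition subalgebra_isomorphic (F : fieldType) (A L : vectType F)
    (brA : {bilinear A -> A -> A}) (brL : {bilinear L -> L -> L})
    (U : {vspace L}) : Prop :=
  exists f : 'Hom(A, L),
    [/\ lker f = 0%VS, limg f = U
      & forall x y : A, f (brA x y) = brL (f x) (f y)].

Definition isomorphic (F : fieldType) (A B : vectType F)
    (brA : {bilinear A -> A -> A}) (brB : {bilinear B -> B -> B}) : Prop :=
  subalgebra_isomorphic brA brB fullv.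

Section Tables.

Variables (F : fieldType) (N : nat).

(* The basis vector e_k of F^N for 1 <= k <= N (and 0 for any other k). *)
Definition evec (k : nat) : 'rV[F]_N := \row_(j < N) (j.+1 == k)%:R.

(* The bracket on F^N with [e_i, e_j] = c i j for 1 <= i, j <= N. *)
Definition table_bracket (c : nat -> nat -> 'rV[F]_N) (u v : 'rV[F]_N) :
    'rV[F]_N :=
  \sum_(i < N) \sum_(j < N) (u 0 i * v 0 j) *: c i.+1 j.+1.

Fact table_bracket_is_bilinear c :
  bilinear_for *:%R *:%R (table_bracket c).
Proof.
split=> w a u v /=; rewrite /table_bracket scaler_sumr -big_split /=;
  apply: eq_bigr => i _; rewrite scaler_sumr -big_split /=;
  apply: eq_bigr => j _; rewrite !mxE scalerA -scalerDl.
- by rewrite mulrDl mulrA.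
- by rewrite mulrDr mulrCA.
Qed.

Fact table_bracketE c i j : (1 <= i <= N)%N -> (1 <= j <= N)%N ->
  table_bracket c (evec i) (evec j) = c i j.
Proof.
case: i j => [//|i] [//|j] /= ltiN ltjN.
rewrite /table_bracket (bigD1 (Ordinal ltiN)) //= [X in _ + X]big1 => [|k nki].
  rewrite addr0 (bigD1 (Ordinal ltjN)) //= [X in _ + X]big1 => [|k nkj].
    by rewrite !mxE !eqxx mulr1 scale1r addr0.
  rewrite !mxE (_ : (k.+1 == j.+1) = false) ?mulr0 ?scale0r //.
  exact/negbTE.
apply: big1 => l _; rewrite !mxE (_ : (k.+1 == i.+1) = false).
  by rewrite mul0r scale0r.
exact/negbTE.
Qed.

HB.instance Definition _ c :=
  bilinear_isBilinear.Build F 'rV[F]_N 'rV[F]_N 'rV[F]_N *:%R *:%R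
    (table_bracket c) (table_bracket_is_bilinear c).

End Tables.

Arguments evec {F N} k.

(* Products of M^{2,lam} among e_1, ..., e_n, as vectors of F^N with N >= n.
   For n >= 3 the branches are mutually exclusive, here and below. *)
Definition M2_table (F : fieldType) (N n : nat) (lam : F) (i j : nat) :
    'rV[F]_N :=
  if (1 <= i <= n - 3)%N && (j == 1)%N then evec i.+1
  else if (i == n - 1)%N && (j == 1)%N then evec n
  else if (i == 1)%N && (j == n - 1)%N then lam *: evec n
  else 0.

Definition M2 (F : fieldType) (n : nat) (lam : F) :
    {bilinear 'rV[F]_n -> 'rV[F]_n -> 'rV[F]_n} :=
  table_bracket (M2_table n n lam).

(* In the two extensions below, x_1 = e_(n+1) and x_2 = e_(n+2). *)
Definition R20_table (F : fieldType) (n i j : nat) : 'rV[F]_(n + 2) :=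
  let x1 := (n + 1)%N in
  let x2 := (n + 2)%N in
  if (1 <= i <= n - 2)%N && (j == x1) then i%:R *: evec i
  else if (i == n) && (j == x1) then evec n
  else if (i == x1) && (j == 1)%N then - evec 1
  else if (i == n - 1)%N && (j == x2) then evec (n - 1)
  else if (i == n) && (j == x2) then evec n
  else M2_table (n + 2) n 0 i j.

Definition R2m1_table (F : fieldType) (n i j : nat) : 'rV[F]_(n + 2) :=
  let x1 := (n + 1)%N in
  let x2 := (n + 2)%N in
  if (1 <= i <= n - 2)%N && (j == x1) then i%:R *: evec i
  else if (i == x1) && (j == 1)%N then - evec 1
  else if (i == n) && (j == x1) then evec n
  else if (i == x1) && (j == n) then - evec n
  else if (i == n - 1)%N && (j == x2) then evec (n - 1)
  else if (i == x2) && (j == n - 1)%N then - evec (n - 1)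
  else if (i == n) && (j == x2) then evec n
  else if (i == x2) && (j == n) then - evec n
  else M2_table (n + 2) n (-1) i j.

Definition R20 (F : fieldType) (n : nat) :
    {bilinear 'rV[F]_(n + 2) -> 'rV[F]_(n + 2) -> 'rV[F]_(n + 2)} :=
  table_bracket (R20_table F n).

Definition R2m1 (F : fieldType) (n : nat) :
    {bilinear 'rV[F]_(n + 2) -> 'rV[F]_(n + 2) -> 'rV[F]_(n + 2)} :=
  table_bracket (R2m1_table F n).

(* Main.v *)
(* Order the basis of M^{2,lam} as e_1, e_(n-1), e_2, e_n, e_3, ..., e_(n-2).
   Derivations of M^{2,lam} are triangular in this order, with diagonal entries
   i a on e_i (i <= n-2), b on e_(n-1) and a + b on e_n; the only exception is
   n = 3, lam = -1 (the Heisenberg algebra), where the basis is first adapted to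
   a common eigenvector of the right multiplications on N / [N, N].  Elements
   of L acting with a = b = 0 generate nilpotent ideals, so [L, L] lies in the
   nilradical N and (a, b) identifies L / N with the plane.  Right multiplication
   by an element x with (a, b) = (1, n) then has simple nonzero spectrum on N, so
   its kernel T on L is an abelian complement of N which acts diagonally, from
   both sides, on the eigenvectors of x in N.  Comparing the left and right
   weights of T by the Leibniz identity leaves only lam = 0 and lam = -1, and
   determines all products.  The two algebras differ because in the first one
   e_(n-1) and e_n, of independent weights, lie in the right annihilator, while
   in the second one all weights of the right annihilator are multiples of a. *)
Require Import Defs.
From HB Require Import structures.
From mathcomp Require Import all_boot all_order all_algebra.
From mathcomp Require Import complex reals.
From mathcomp Require Import zify ring.

Set Implicit Arguments.
Unset Strict Implicit.
Unset Printing Implicit Defensive.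

Import GRing.Theory Num.Theory.
Local Open Scope ring_scope.

(** * Coordinates of row vectors, numbered from 1 *)

Section Coordinates.
Variables (F : fieldType) (N : nat).
Implicit Types (u v : 'rV[F]_N) (k : nat).

(* Total in [k]: it is 0 unless 1 <= k <= N. *)
Definition ecoef k u : F := \sum_(j < N | j.+1 == k) u 0 j.

Fact ecoef_is_linear k : scalar (ecoef k).
Proof.
move=> a u v; rewrite /ecoef mulr_sumr -big_split /=.
by apply: eq_bigr => i _; rewrite !mxE.
Qed.

HB.instance Definition _ k := GRing.isLinear.Build F 'rV[F]_N F *%R
  (ecoef k) (ecoef_is_linear k).

Lemma ecoefS (j : 'I_N) u : ecoef j.+1 u = u 0 j.
Proof. by rewrite /ecoef (big_pred1 j). Qed.

Lemma ecoef_out k u : ~~ (1 <= k <= N)%N -> ecoef k u = 0.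
Proof.
move=> kN; rewrite /ecoef big_pred0 // => j; apply: contraNF kN => /eqP <-.
by rewrite ltn_ord.
Qed.

Lemma ecoef_evec k i : (1 <= i <= N)%N ->
  ecoef k (evec i : 'rV[F]_N) = (k == i)%:R.
Proof.
move=> iN; have [kN|kN] := boolP (1 <= k <= N)%N; last first.
  by rewrite ecoef_out //; case: eqVneq => // ki; rewrite ki iN in kN.
by case: k kN => // k kN; rewrite (ecoefS (Ordinal kN)) mxE.
Qed.

Lemma ecoef_ext u v :
  (forall k, (1 <= k <= N)%N -> ecoef k u = ecoef k v) -> u = v.
Proof.
by move=> uv; apply/rowP=> j; rewrite -!ecoefS; apply: uv; rewrite ltn_ord.
Qed.

Lemma sum_evec u : u = \sum_(i < N) ecoef i.+1 u *: evec i.+1.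
Proof.
rewrite [LHS]row_sum_delta; apply: eq_bigr => i _; rewrite ecoefS.
by congr (_ *: _); apply/rowP=> j; rewrite !mxE.
Qed.

Lemma sum_ecoef_eq k u :
  \sum_(i < N) ecoef i.+1 u * (i.+1 == k)%:R = ecoef k u.
Proof.
rewrite /ecoef [RHS]big_mkcond /=; apply: eq_bigr => i _.
by rewrite -/(ecoef _ u) ecoefS; case: eqP; rewrite ?mulr1 ?mulr0.
Qed.

Lemma ecoef_lin (D : 'End('rV[F]_N)) k u :
  ecoef k (D u) = \sum_(i < N) ecoef i.+1 u * ecoef k (D (evec i.+1)).
Proof.
rewrite [in LHS](sum_evec u) !linear_sum /=; apply: eq_bigr => i _.
by rewrite !linearZ.
Qed.

End Coordinates.

(** * The bracket of $M^{2,\lambda}$ in coordinates *)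

Section M2Bracket.
Variables (F : fieldType) (n : nat) (lam : F).
Hypothesis n_ge3 : (3 <= n)%N.
Implicit Types u v : 'rV[F]_n.

Lemma ecoef_M2 k u v : ecoef k (M2 n lam u v) =
  (ecoef k.-1 u * ecoef 1 v) *+ (2 <= k <= n - 2)%N
  + (ecoef (n - 1) u * ecoef 1 v + lam * ecoef 1 u * ecoef (n - 1) v)
    *+ (k == n).
Proof.
rewrite /M2 /= /table_bracket linear_sum /=.
under eq_bigr => i _ do (rewrite linear_sum /=;
  under eq_bigr => j _ do rewrite linearZ /= -!ecoefS).
(* As [n >= 3] makes the branches of the table exclusive, each entry is a sum of indicators; [dsum]
   then collapses the double sum. *)
have tabE i j : ecoef k (M2_table n n lam i j : 'rV_n) =
  ((i == k.-1) && (2 <= k <= n - 2) && (j == 1))%N%:R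
  + ((i == n - 1) && (j == 1) && (k == n))%N%:R
  + lam * ((i == 1) && (j == n - 1) && (k == n))%N%:R.
  rewrite /M2_table.
  case: ifP => [/andP[iP /eqP ->]|h1].
    rewrite ecoef_evec; last by lia.
    have -> : (i == n - 1)%N = false by lia.
    have -> : (1 == n - 1)%N = false by lia.
    rewrite !andbF /= addr0 mulr0 addr0 andbT; congr (nat_of_bool _)%:R; lia.
  case: ifP => [/andP[/eqP -> /eqP ->]|h2].
    rewrite ecoef_evec ?eqxx /=; last by lia.
    have -> : (n - 1 == 1)%N = false by lia.
    rewrite /= mulr0 addr0 andbT.
    have -> : ((n - 1 == k.-1) && (1 < k <= n - 2))%N = false by lia.
    by rewrite add0r.
  case: ifP => [/andP[/eqP -> /eqP ->]|h3].
    rewrite linearZ /= ecoef_evec; last by lia.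
    have -> : (n - 1 == 1)%N = false by lia.
    by rewrite !andbF !add0r.
  rewrite linear0.
  have -> : ((i == k.-1) && (1 < k <= n - 2) && (j == 1))%N = false by lia.
  by rewrite /= mulr0 !addr0.
under eq_bigr => i _ do under eq_bigr => j _ do rewrite tabE.
have dsum (a b : nat) (c : bool) : \sum_(i < n) \sum_(j < n)
    ecoef i.+1 u * ecoef j.+1 v * ((i.+1 == a) && (j.+1 == b) && c)%:R
    = (ecoef a u * ecoef b v) *+ c.
  rewrite -(sum_ecoef_eq a u) -(sum_ecoef_eq b v) mulr_suml -sumrMnl.
  apply: eq_bigr => i _; rewrite mulr_sumr -sumrMnl; apply: eq_bigr => j _.
  by rewrite -!mulnb !natrM -mulr_natr; ring.
transitivity ((ecoef k.-1 u * ecoef 1 v) *+ (2 <= k <= n - 2)%N +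
   (ecoef (n - 1) u * ecoef 1 v) *+ (k == n) +
   lam * ((ecoef 1 u * ecoef (n - 1) v) *+ (k == n))); last first.
  by case: (k == n); case: (_ <= _ <= _)%N => /=; rewrite ?mulr1n ?mulr0n; ring.
rewrite -!dsum mulr_sumr -!big_split /=; apply: eq_bigr => i _.
rewrite mulr_sumr -!big_split /=; apply: eq_bigr => j _.
rewrite (andbAC (_ == k.-1)); ring.
Qed.

End M2Bracket.

(** * Derivations of $M^{2,\lambda}$ *)

Section Derivations.
Variables (F : fieldType) (n : nat) (lam : F).
Hypothesis n_ge3 : (3 <= n)%N.
Implicit Types (u v : 'rV[F]_n) (D : 'End('rV[F]_n)) (i j k : nat).

Local Notation m2 := (M2 n lam).
Local Notation e := (@evec F n).

Definition derivation D :=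
  forall u v, D (m2 u v) = m2 (D u) v + m2 u (D v).

(* The order e_1, e_(n-1), e_2, e_n, e_3, e_4, ..., e_(n-2) of the basis, in
   which derivations become triangular. *)
Definition rank i : nat :=
  if i == (n - 1)%N then 2 else if i == n then 4 else (i.*2 - 1)%N.

Lemma rank_inj i j : (1 <= i <= n)%N -> (1 <= j <= n)%N ->
  rank i = rank j -> i = j.
Proof. rewrite /rank; do !case: ifP; lia. Qed.

(* The eigenvalue on e_i of a triangular derivation with eigenvalues a on e_1
   and b on e_(n-1). *)
Definition weight (a b : F) i : F :=
  if (i <= n - 2)%N then i%:R * a else if i == (n - 1)%N then b else a + b.

Lemma M2_evec1 i : (1 <= i <= n - 3)%N -> m2 (e i) (e 1%N) = e i.+1.
Proof.
move=> iP; rewrite /M2 /= table_bracketE; [|lia..].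
by rewrite /M2_table iP.
Qed.

Lemma M2_evecn : m2 (e (n - 1)%N) (e 1%N) = e n.
Proof.
rewrite /M2 /= table_bracketE; [|lia..].
by rewrite /M2_table !eqxx; case: ifP => [|_] //; lia.
Qed.

Lemma ecoef_M2_e1 k u : ecoef k (m2 u (e 1%N)) =
  ecoef k.-1 u *+ (2 <= k <= n - 2)%N + ecoef (n - 1) u *+ (k == n).
Proof.
rewrite ecoef_M2 // !ecoef_evec; [|lia..].
have -> : (n - 1 == 1)%N = false by lia.
by rewrite !mulr1 mulr0 addr0.
Qed.

(** Let [c] be this coordinate. The Leibniz rule on $[e_{n-1},e_{n-1}]=0$ gives $c(1+\lambda)=0$.
    For $n\ge 4$, the $e_2$ coordinates of $De_n$ and of $D[e_1,e_{n-1}]=\lambda De_n$ are both $c$,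
    so $\lambda c=c$ and $2c=0$. *)
Lemma derivation_off_diagonal D : 2 != 0 :> F -> derivation D ->
  (4 <= n)%N || (lam != -1) ->
  ecoef 1 (D (e (n - 1)%N)) = 0.
Proof.
move=> nz2 derD; set c := ecoef _ _.
have c1 : c * lam + c = 0.
  have := derD (e (n - 1)%N) (e (n - 1)%N).
  have -> : m2 (e (n - 1)%N) (e (n - 1)%N) = 0.
    apply: ecoef_ext => k kn; rewrite ecoef_M2 // !ecoef_evec ?linear0; [|lia..].
    have -> : (1 == n - 1)%N = false by lia.
    by rewrite /= !mulr0 mul0r addr0 !mul0rn addr0.
  rewrite linear0 => /(congr1 (ecoef n)); rewrite linear0 linearD /=.
  rewrite !ecoef_M2 // !ecoef_evec -/c ?eqxx ?mulr1n; [|lia..].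
  have -> : (1 == n - 1)%N = false by lia.
  have -> : (1 < n <= n - 2)%N = false by lia.
  by rewrite !mulr0n /= !(mulr0, mul0r, add0r, addr0, mulr1, mul1r) => ->; ring.
case/orP=> [n_ge4|lamN1]; last first.
  apply/eqP; have /eqP := c1; rewrite -{2}[c]mulr1 -mulrDr mulf_eq0.
  by rewrite addr_eq0 (negbTE lamN1) orbF.
have Den : ecoef 2 (D (e n)) = c.
  rewrite -M2_evecn derD linearD /= ecoef_M2_e1 ecoef_M2 // -/c !ecoef_evec ?eqxx; [|lia..].
  have -> : (2 <= 2 <= n - 2)%N by lia.
  have -> : (2 == n)%N = false by lia.
  have -> : (2.-1 == n - 1)%N = false by lia.
  by rewrite !(mulr0n, mulr1n) /= mul0r !addr0.
have : ecoef 2 (D (m2 (e 1%N) (e (n - 1)%N))) = c.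
  rewrite derD linearD /= !ecoef_M2 // -/c !ecoef_evec ?eqxx; [|lia..].
  have -> : (2 <= 2 <= n - 2)%N by lia.
  have -> : (2 == n)%N = false by lia.
  have -> : (1 == n - 1)%N = false by lia.
  by rewrite !(mulr0n, mulr1n) /= mulr0 !addr0 add0r mul1r.
have -> : m2 (e 1%N) (e (n - 1)%N) = lam *: e n.
  rewrite /M2 /= table_bracketE; [|lia..].
  rewrite /M2_table !eqxx; do 2 (case: ifP => [|_]; first by lia).
  by [].
rewrite !linearZ /= Den mulrC => cE; move: c1; rewrite cE => c1.
by apply/eqP; move/eqP: c1; rewrite -mulr2n -mulr_natr mulf_eq0 (negbTE nz2) orbF.
Qed.

(** The vectors $e_1$ and $e_{n-1}$ generate the algebra, so the Leibniz rule carries their leading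
    coefficients to $e_n=[e_{n-1},e_1]$ and, inductively, to $e_{i+1}=[e_i,e_1]$. *)
Lemma derivation_triangular D : derivation D -> ecoef 1 (D (e (n - 1)%N)) = 0 ->
  forall i j, (1 <= i <= n)%N -> (1 <= j <= n)%N -> (rank j <= rank i)%N ->
  ecoef j (D (e i)) =
    weight (ecoef 1 (D (e 1%N))) (ecoef (n - 1) (D (e (n - 1)%N))) i
      *+ (j == i).
Proof.
move=> derD offD.
set a := ecoef 1 (D (e 1%N)); set b := ecoef _ (D (e (n - 1)%N)).
have Hn1 j : (1 <= j <= n)%N -> (rank j <= rank (n - 1))%N ->
    ecoef j (D (e (n - 1)%N)) = weight a b (n - 1)%N *+ (j == n - 1)%N.
  move=> jn; have [->|jn1] := eqVneq j (n - 1)%N.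
    by move=> _; rewrite /weight eqxx; case: ifP => //; lia.
  rewrite /rank eqxx (negbTE jn1) mulr0n; case: ifP => [|/eqP]; first by lia.
  by move=> ? ?; have -> : j = 1%N by lia.
have Hn j : (1 <= j <= n)%N -> (rank j <= rank n)%N ->
    ecoef j (D (e n)) = weight a b n *+ (j == n).
  move=> jn; rewrite -M2_evecn derD linearD /= ecoef_M2_e1 ecoef_M2 //.
  rewrite -/a -/b !ecoef_evec ?eqxx; [|lia..].
  have -> : (1 == n - 1)%N = false by lia.
  have [->|njn] := eqVneq j n.
    have -> : (1 < n <= n - 2)%N = false by lia.
    rewrite /weight; do 2 (case: ifP => [|_]; first by lia).
    by move=> _; rewrite !(mulr0n, mulr1n) /=; ring.
  rewrite /rank (negbTE njn); have -> : (n == n - 1)%N = false by lia.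
  case: ifP => [/eqP-> _|/negP jn1].
    have -> : (1 < n - 1 <= n - 2)%N = false by lia.
    by rewrite !mulr0n !addr0.
  rewrite eqxx => rj; have [j2|j2] := boolP (2 <= j <= n - 2)%N; last first.
    by rewrite !mulr0n !addr0.
  (* The $e_2$ coordinate of $[De_{n-1},e_1]$ is the $e_1$ coordinate of $De_{n-1}$, which [offD]
     kills. *)
  have -> : j = 2 by lia.
  have -> : (2.-1 == n - 1)%N = false by lia.
  by rewrite offD !(mulr0n, mulr1n) /= mul0r !addr0.
have Hi i : (1 <= i <= n - 2)%N -> forall j, (1 <= j <= n)%N ->
    (rank j <= rank i)%N -> ecoef j (D (e i)) = weight a b i *+ (j == i).
  elim: i => // -[_ _|i IHi iP] j jn.
    rewrite /rank; have -> : (1 == n - 1)%N = false by lia.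
    have -> : (1 == n)%N = false by lia.
    do 2 (case: ifP => [_|/eqP ?]; first by lia); move=> ?.
    have -> : j = 1%N by lia.
    by rewrite eqxx mulr1n /weight ifT ?mul1r //; lia.
  rewrite -M2_evec1; last by lia.
  rewrite derD linearD /= ecoef_M2_e1 ecoef_M2 // -/a !ecoef_evec; [move=> rj|lia..].
  have IH k : (1 <= k <= n)%N -> (rank k <= rank i.+1)%N -> 
      ecoef k (D (e i.+1)) = weight a b i.+1 *+ (k == i.+1).
    by apply: IHi; lia.
  have -> : (n - 1 == i.+1)%N = false by lia.
  have ri : rank i.+2 = i.+1.*2.+1.
    by rewrite /rank; do 2 (case: ifP => [|_]; first by lia); lia.
  have ri1 : rank i.+1 = i.+1.*2.-1.
    by rewrite /rank; do 2 (case: ifP => [|_]; first by lia); lia.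
  (* As $e_n$ has rank 4, this case excludes $e_{i+2}=e_2$, whose image may have an $e_n$
     component. *)
  have [jen|njn] := eqVneq j n.
    have -> : (1 < j <= n - 2)%N = false by lia.
    have -> : (j == i.+2) = false by lia.
    have rn : rank j = 4.
      by rewrite /rank jen eqxx; case: ifP => //; lia.
    have -> : (1 == i.+1)%N = false by lia.
    rewrite (IH (n - 1)%N); [|lia|].
      have -> : (n - 1 == i.+1)%N = false by lia.
      by rewrite !(mulr0n, mulr1n) /= !(mulr0, mul0r, addr0).
    by rewrite ri1 /rank eqxx; lia.
  have [j2|j2] := boolP (2 <= j <= n - 2)%N; last first.
    have -> : (j == i.+2) = false by lia.
    by rewrite !mulr0n !addr0.
  have rjE : rank j = j.*2.-1.
    by rewrite /rank; do 2 (case: ifP => [|_]; first by lia); lia.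
  have rj1E : rank j.-1 = j.-1.*2.-1.
    by rewrite /rank; do 2 (case: ifP => [|_]; first by lia); lia.
  rewrite (IH j.-1); [|lia|lia].
  have -> : (j == i.+2) = (j.-1 == i.+1) by lia.
  rewrite !mulr0n !mulr1n !addr0 /weight.
  have -> : (i.+1 <= n - 2)%N by lia.
  have -> : (i.+2 <= n - 2)%N by lia.
  case: (_ == _); rewrite !(mulr0n, mulr1n) ?mul0r ?addr0 //.
  by rewrite -[in RHS](addn1 i.+1) natrD; ring.
move=> i j iP jP; have [->|ni] := eqVneq i n; first exact: Hn.
have [->|ni1] := eqVneq i (n - 1)%N; first exact: Hn1.
by apply: Hi => //; lia.
Qed.
End Derivations.

(** * Flags and triangular endomorphisms for a reordered basis *)

Section Triangular.
Variables (F : fieldType) (N : nat) (r : nat -> nat).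
Hypothesis r_inj : forall i j, (1 <= i <= N)%N -> (1 <= j <= N)%N ->
  r i = r j -> i = j.
Implicit Types (u v : 'rV[F]_N) (D : 'End('rV[F]_N)) (i j k : nat).

Definition in_flag k u :=
  forall j, (1 <= j <= N)%N -> (r j < k)%N -> ecoef j u = 0.

Lemma in_flagW k k' u : (k <= k')%N -> in_flag k' u -> in_flag k u.
Proof. by move=> kk' uf j jN rj; apply: uf => //; apply: leq_trans kk'. Qed.

Lemma in_flagD k u v : in_flag k u -> in_flag k v -> in_flag k (u + v).
Proof. by move=> uf vf j jN rj; rewrite linearD /= uf ?vf ?addr0. Qed.

Lemma in_flagZ k c u : in_flag k u -> in_flag k (c *: u).
Proof. by move=> uf j jN rj; rewrite linearZ /= uf ?mulr0. Qed.

Lemma in_flagN k u : in_flag k u -> in_flag k (- u).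
Proof. by move=> uf j jN rj; rewrite linearN /= uf ?oppr0. Qed.

Lemma in_flag_evec i : (1 <= i <= N)%N -> in_flag (r i) (evec i).
Proof.
move=> iN j jN rj; rewrite ecoef_evec //; case: eqP rj => // ->.
by rewrite ltnn.
Qed.

Lemma in_flagS i u : (1 <= i <= N)%N ->
  in_flag (r i) u -> ecoef i u = 0 -> in_flag (r i).+1 u.
Proof.
move=> iN uf ui j jN; rewrite ltnS leq_eqVlt => /orP[/eqP rij|]; last exact: uf.
by rewrite (r_inj jN iN rij).
Qed.

(** A nonzero vector has a nonzero coordinate of least order, and lies in the flag of that order; so
    it is enough to kill leading coordinates. *)
Lemma in_flag_ind u : (forall i, (1 <= i <= N)%N -> in_flag (r i) u ->
  ecoef i u = 0) -> u = 0.
Proof.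
move=> uind; apply: ecoef_ext => i; rewrite linear0; move: {2}(r i) (leqnn (r i)).
move=> m; elim: m i => [|m IHm] i rim iN; apply: uind => // j jN rji.
  by move: rji; rewrite (leqn0 (r i)) in rim; rewrite (eqP rim).
by apply: IHm => //; rewrite -ltnS; apply: leq_trans rim.
Qed.

(** The kernel of the projection onto the coordinates of order below [k]: the flag as a subspace, to
    be compared with [lower_central_series]. *)
Definition flagv k : {vspace 'rV[F]_N} :=
  lker (linfun (mulmxr (diag_mx (\row_(j < N) (r j.+1 < k)%:R)))).

Lemma flagvP k u : reflect (in_flag k u) (u \in flagv k).
Proof.
rewrite memv_ker lfunE /=; apply: (iffP eqP) => [/rowP uk [//|j] jN rj|uk].
  have := uk (Ordinal jN); rewrite mul_mx_diag !mxE rj mulr1 => uj.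
  by rewrite (ecoefS (Ordinal jN)).
apply/rowP=> j; rewrite mul_mx_diag !mxE.
by case: ltnP => rj; rewrite ?mulr0 // -ecoefS uk ?ltn_ord ?mul0r.
Qed.

Lemma triangular_free (v : nat -> 'rV[F]_N) (c : nat -> F) :
  (forall i, (1 <= i <= N)%N -> in_flag (r i) (v i) /\ ecoef i (v i) = 1) ->
  \sum_(i < N) c i.+1 *: v i.+1 = 0 -> forall i, (1 <= i <= N)%N -> c i = 0.
Proof.
move=> vP cv0; pose u := \sum_(i < N) c i.+1 *: (evec i.+1 : 'rV_N).
have ucE i : (1 <= i <= N)%N -> ecoef i u = c i.
  move=> iN; rewrite linear_sum /=; case: i iN => // i iN.
  rewrite (bigD1 (Ordinal iN)) //= linearZ /= ecoef_evec // eqxx mulr1.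
  rewrite big1 ?addr0 // => j; rewrite -val_eqE /= eq_sym => /negbTE ji.
  by rewrite linearZ /= ecoef_evec ?eqSS ?ji ?mulr0 // ltn_ord.
suff u0 : u = 0 by move=> i iN; rewrite -ucE // u0 linear0.
apply: in_flag_ind => i iN uf; rewrite ucE //.
have := congr1 (ecoef i) cv0; rewrite linear0 linear_sum /=.
case: i iN uf => // i iN uf; rewrite (bigD1 (Ordinal iN)) //= linearZ /=.
rewrite (vP i.+1 iN).2 mulr1 big1 ?addr0 // => j; rewrite -val_eqE /= => ji.
have jN : (1 <= j.+1 <= N)%N by rewrite ltn_ord.
rewrite linearZ /=; case: (ltngtP (r j.+1) (r i.+1)) => rij.
- by rewrite -ucE // uf ?mul0r.
- by rewrite (vP _ jN).1 ?mulr0.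
- by have [/eqP] := r_inj jN iN rij; rewrite (negbTE ji).
Qed.

Section Eigenvectors.
Variables (D : 'End('rV[F]_N)) (mu : nat -> F).
Hypothesis triD : forall i j, (1 <= i <= N)%N -> (1 <= j <= N)%N ->
  (r j <= r i)%N -> ecoef j (D (evec i)) = mu i *+ (j == i).

(** Coordinates of smaller order vanish on [u], and basis vectors of larger order contribute nothing
    to coordinate [i] of [D u]. *)
Lemma triangular_lead i u : (1 <= i <= N)%N -> in_flag (r i) u ->
  ecoef i (D u) = ecoef i u * mu i.
Proof.
case: i => // i iN uf; rewrite ecoef_lin (bigD1 (Ordinal iN)) //=.
rewrite triD // eqxx big1 ?addr0 // => j; rewrite -val_eqE /= => ji.
have jN : (1 <= j.+1 <= N)%N by rewrite ltn_ord.
case: (ltnP (r j.+1) (r i.+1)) => rij; first by rewrite uf ?mul0r.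
by rewrite triD // eqSS eq_sym (negbTE ji) mulr0.
Qed.

(** Comparing leading coordinates, a nonzero one can occur only at an index [i] with [mu i = c]. *)
Lemma eigenvector_eq0 c u : D u = c *: u ->
  (forall i, (1 <= i <= N)%N -> mu i = c -> ecoef i u = 0) -> u = 0.
Proof.
move=> Du uc; apply: in_flag_ind => i iN uf.
have := triangular_lead iN uf; rewrite Du linearZ /= mulrC => /eqP.
rewrite -subr_eq0 -mulrBr mulf_eq0 subr_eq0 => /orP[/eqP//|/eqP cE].
exact: uc.
Qed.

Lemma in_flag_triangular k u : in_flag k u -> in_flag k (D u).
Proof.
move=> uf j jN rj; rewrite triangular_lead ?uf ?mul0r //.
exact: in_flagW (ltnW rj) uf.
Qed.

(** Starting from $e_i$, the error [D v - mu i *: v] is removed order by order. *)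
Lemma eigenvector_exists i : (1 <= i <= N)%N ->
  (forall j, (1 <= j <= N)%N -> j != i -> mu j != mu i) ->
  exists v, [/\ D v = mu i *: v, in_flag (r i) v & ecoef i v = 1].
Proof.
move=> iN mu_neq.
have step k : exists v, [/\ in_flag ((r i).+1 + k) (D v - mu i *: v),
    in_flag (r i) v & ecoef i v = 1].
  elim: k => [|k [v [Dvf vf vi]]].
    exists (evec i); split; [|exact: in_flag_evec|by rewrite ecoef_evec ?eqxx].
    rewrite addn0; apply: in_flagS => //.
      apply: in_flagD; first exact/in_flag_triangular/in_flag_evec.
      exact/in_flagN/in_flagZ/in_flag_evec.
    rewrite linearB linearZ /= triD // ecoef_evec // eqxx mulr1n.
    by rewrite mulr1 subrr.
  set K := ((r i).+1 + k)%N in Dvf.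
  (* [r] may skip values: without a basis vector of order [K] there is nothing to correct. *)
  have [/existsP[[j jN] /= /eqP rj]|/existsPn noK] :=
      boolP [exists j : 'I_N, r j.+1 == K]; last first.
    exists v; split=> // j jN; rewrite addnS -/K ltnS leq_eqVlt => /orP[|].
      by case: j jN => // j jN; rewrite (negbTE (noK (Ordinal jN))).
    exact: Dvf.
  have jN' : (1 <= j.+1 <= N)%N by [].
  have ji : j.+1 != i.
    by apply/eqP=> ji; move: rj; rewrite ji /K; lia.
  have muji : mu j.+1 - mu i != 0 by rewrite subr_eq0 mu_neq.
  (* [D - mu i] scales the leading coordinate of $e_{j+1}$ by the nonzero [mu j.+1 - mu i], so
     subtracting [t *: evec j.+1] cancels the error at order [K]. *)
  pose t := ecoef j.+1 (D v - mu i *: v) / (mu j.+1 - mu i).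
  exists (v - t *: evec j.+1); split.
  - have -> : D (v - t *: evec j.+1) - mu i *: (v - t *: evec j.+1) =
        (D v - mu i *: v) - t *: (D (evec j.+1) - mu i *: evec j.+1).
      rewrite linearB linearZ /= !scalerBr !scalerA (mulrC t).
      by rewrite !opprD !opprK addrACA.
    rewrite addnS -/K -rj; apply: in_flagS; rewrite ?rj //.
      apply/in_flagD/in_flagN/in_flagZ => //; rewrite -rj.
      apply: in_flagD; first exact/in_flag_triangular/in_flag_evec.
      exact/in_flagN/in_flagZ/in_flag_evec.
    have yE : ecoef j.+1 (D (evec j.+1) - mu i *: evec j.+1) = mu j.+1 - mu i.
      by rewrite linearB linearZ /= triD // ecoef_evec // eqxx mulr1n mulr1.
    by rewrite linearB [X in _ - X]linearZ /= yE divfK ?subrr.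
  - apply/in_flagD/in_flagN/in_flagZ => //.
    by apply: in_flagW (in_flag_evec jN'); rewrite rj /K; lia.
  - by rewrite linearB linearZ /= ecoef_evec // vi eq_sym (negbTE ji) mulr0 subr0.
(* Beyond the largest order the flag is zero, and so is the error. *)
have [v [Dvf vf vi]] := step (\max_(j < N) r j.+1).
exists v; split=> //; apply/subr0_eq/ecoef_ext => -[//|j] jN; rewrite linear0.
by apply: Dvf => //; rewrite addSn ltnS; apply: leq_trans (leq_addl _ _);
   apply: (leq_bigmax (Ordinal jN)).
Qed.

End Eigenvectors.
End Triangular.

(** * Brackets of subspaces and solvability *)

Section BracketSpaces.
Variables (F : fieldType) (L : vectType F) (br : {bilinear L -> L -> L}).
Implicit Types (U V W N : {vspace L}) (x y z : L).

Lemma memv_brv U V x y : x \in U -> y \in V -> br x y \in brv br U V.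
Proof.
move=> xU yV; rewrite (coord_vbasis xU) (coord_vbasis yV) linear_sumlz.
apply: memv_suml => i _; rewrite linear_sumr; apply: memv_suml => j _ /=.
rewrite linearZl_LR linearZr_LR /=; do 2 apply: memvZ; apply: memv_span.
by apply/allpairsP; exists ((vbasis U)`_i, (vbasis V)`_j); rewrite /= !mem_nth
  ?size_tuple.
Qed.

Lemma brv_subv U V W : (forall x y, x \in U -> y \in V -> br x y \in W) ->
  (brv br U V <= W)%VS.
Proof.
move=> UVW; apply/span_subvP => z /allpairsP[[x y] /= [xU yV ->]].
by apply: UVW; apply: vbasis_mem.
Qed.

Lemma brvS U U' V V' : (U <= U')%VS -> (V <= V')%VS ->
  (brv br U V <= brv br U' V')%VS.
Proof.
move=> /subvP UU' /subvP VV'; apply: brv_subv => x y xU yV.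
by apply: memv_brv; [apply: UU'|apply: VV'].
Qed.

(** Modulo [N], the space [V] lies in its own derived space, hence in every term of the derived
    series, the last of which is 0. *)
Lemma solvable_subv_ideal N V : ideal br N -> solvable_algebra br ->
  (V <= brv br V V + N)%VS -> (V <= N)%VS.
Proof.
move=> [NL LN] [m Lm0] VN.
suff VD s : (V <= derived_series br fullv s + N)%VS.
  by have := VD m; rewrite Lm0 add0v.
elim: s => [|s IHs]; first by rewrite (subv_trans (subvf _)) ?addvSl.
apply: subv_trans VN _; rewrite subv_add addvSr andbT.
apply: subv_trans (brvS IHs IHs) _; apply: brv_subv => x y.
move=> /memv_addP[x1 x1D [x2 x2N ->]] /memv_addP[y1 y1D [y2 y2N ->]].
rewrite linearDr /= linearDl /= -addrA memv_add ?memv_brv // memvD //.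
  by apply: (subvP NL); rewrite memv_brv ?memvf.
by apply: (subvP LN); rewrite memv_brv ?memvf.
Qed.

Lemma brv_ideal N U V : ideal br N -> (U <= N)%VS -> (brv br U V <= N)%VS.
Proof.
by move=> [NL _] UN; apply: subv_trans NL; apply: brvS; rewrite ?subvf.
Qed.

(* Solvability makes the inclusions [I, I] + N <= I <= L strict. *)
Lemma solvable_derived2 N : ideal br N -> solvable_algebra br ->
  \dim {:L} = (\dim N + 2)%N ->
  let I := (brv br fullv fullv + N)%VS in
  (\dim I <= \dim N + 1)%N /\ (brv br I I <= N)%VS.
Proof.
move=> idN solL dimL I.
have NI : (N <= I)%VS by apply: addvSr.
have dimI : (\dim I <= \dim N + 1)%N.
  rewrite -ltnS -addnS -dimL ltn_neqAle (dimvS (subvf I)) andbT.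
  rewrite (dimv_leqif_sup (subvf I)); apply/negP.
  move=> /(solvable_subv_ideal idN solL) /dimvS; lia.
split=> //; have [IJ|IJ] := boolP (I <= brv br I I + N)%VS.
  exact/(brv_ideal _ idN)/(solvable_subv_ideal idN solL).
have JI : (brv br I I + N <= I)%VS.
  by rewrite subv_add NI andbT (subv_trans (brvS (subvf I) (subvf I))) ?addvSl.
have NJ : (N <= brv br I I + N)%VS by apply: addvSr.
have [dJI dJI'] := dimv_leqif_sup JI; rewrite (negbTE IJ) in dJI'.
have [_ dNJ] := dimv_leqif_sup NJ; apply: subv_trans (addvSl _ N) _.
by rewrite -dNJ eqn_leq dimvS //=; move/eqP: dJI'; lia.
Qed.

End BracketSpaces.

(** * Isomorphisms given by a basis *)

Section BasisMap.
Variables (F : fieldType) (N : nat) (L : vectType F).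
Variables (br : {bilinear L -> L -> L}) (g : nat -> L).

Definition basis_map (u : 'rV[F]_N) : L := \sum_(i < N) u 0 i *: g i.+1.

Fact basis_map_is_linear : linear basis_map.
Proof.
move=> c u v; rewrite /basis_map scaler_sumr -big_split /=.
by apply: eq_bigr => i _; rewrite !mxE scalerDl scalerA.
Qed.

HB.instance Definition _ := GRing.isLinear.Build F 'rV[F]_N L *:%R
  basis_map basis_map_is_linear.

Lemma basis_map_evec k : (1 <= k <= N)%N -> basis_map (evec k) = g k.
Proof.
case: k => // k kN; rewrite /basis_map (bigD1 (Ordinal kN)) //= mxE eqxx scale1r.
rewrite big1 ?addr0 // => j; rewrite -val_eqE /= mxE eqSS => /negbTE ->.
by rewrite scale0r.
Qed.

Lemma basis_map_isomorphism (c : nat -> nat -> 'rV[F]_N) : \dim {:L} = N ->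
  (forall a : nat -> F, \sum_(i < N) a i.+1 *: g i.+1 = 0 ->
     forall i, (1 <= i <= N)%N -> a i = 0) ->
  (forall i j, (1 <= i <= N)%N -> (1 <= j <= N)%N ->
     basis_map (c i j) = br (g i) (g j)) ->
  [/\ lker (linfun basis_map) = 0%VS, limg (linfun basis_map) = fullv
    & forall u v, linfun basis_map (table_bracket c u v) =
        br (linfun basis_map u) (linfun basis_map v)].
Proof.
move=> dimL free_g cE; have ker0 : lker (linfun basis_map) = 0%VS.
  apply/eqP; rewrite -subv0; apply/subvP => u; rewrite memv_ker lfunE /= => /eqP u0.
  rewrite memv0; apply/eqP/ecoef_ext => i iN; rewrite linear0.
  apply: (free_g (fun i => ecoef i u)) => //; rewrite -[RHS]u0.
  by apply: eq_bigr => j _; rewrite ecoefS.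
split=> // [|u v].
  apply/eqP; rewrite eqEdim subvf /= dimL.
  have := limg_ker_dim (linfun basis_map) fullv.
  by rewrite ker0 capv0 dimv0 add0n dimvf /dim /= mul1n => ->.
rewrite !lfunE /= linear_sum /= linear_sumlz; apply: eq_bigr => i _.
rewrite linear_sum linear_sumr; apply: eq_bigr => j _ /=.
by rewrite linearZ /= cE ?ltn_ord // linearZl_LR linearZr_LR /= scalerA.
Qed.

End BasisMap.

(** * Right multiplications on the nilradical *)

Section RightMultiplication.
Variables (F : fieldType) (n : nat) (lam : F).
Variables (L : vectType F) (br : {bilinear L -> L -> L}) (N : {vspace L}).
Variable f : 'Hom('rV[F]_n, L).
Implicit Types (u v : 'rV[F]_n) (x y z : L).

(* Right multiplication by y, read on F^n through f; only meaningful if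
   [limg f, y] is contained in limg f. *)
Definition rmult y : 'End('rV[F]_n) := (f^-1 \o linfun (applyr br y) \o f)%VF.

Hypotheses (leib : leibniz_identity br) (idN : ideal br N).
Hypotheses (kerf : lker f = 0%VS) (imf : limg f = N).
Hypothesis f_morph : forall u v, f (M2 n lam u v) = br (f u) (f v).

Lemma f_inj : injective f.
Proof. by apply/lker0P; rewrite kerf. Qed.

Lemma f_mem u : f u \in N.
Proof. by rewrite -imf memv_img ?memvf. Qed.

Lemma memN x : x \in N -> exists u, x = f u.
Proof. by rewrite -imf => /memv_imgP[u _ ->]; exists u. Qed.

Lemma br_meml x y : x \in N -> br x y \in N.
Proof. by move=> xN; apply: (subvP idN.1); rewrite memv_brv ?memvf. Qed.

Lemma f_rmult y u : f (rmult y u) = br (f u) y.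
Proof.
by rewrite !comp_lfunE lfunE /= limg_lfunVK // imf br_meml ?f_mem.
Qed.

Lemma rmultP c y z u : rmult (c *: y + z) u = c *: rmult y u + rmult z u.
Proof. by apply: f_inj; rewrite linearP /= !f_rmult linearPr. Qed.

Lemma rmult_br y z u :
  rmult (br y z) u = rmult z (rmult y u) - rmult y (rmult z u).
Proof. by apply: f_inj; rewrite linearB /= !f_rmult leib. Qed.

Lemma rmult_f v u : rmult (f v) u = M2 n lam u v.
Proof. by apply: f_inj; rewrite f_rmult f_morph. Qed.

(** This is the Leibniz identity itself, rearranged. *)
Lemma derivation_rmult y : derivation lam (rmult y).
Proof.
move=> u v; apply: f_inj; rewrite linearD /= !(f_rmult, f_morph) leib.
by rewrite addrC subrK.
Qed.

Lemma dim_N : \dim N = n.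
Proof.
have := limg_ker_dim f fullv; rewrite kerf capv0 dimv0 add0n imf => ->.
by rewrite dimvf /dim /= mul1n.
Qed.

Hypothesis n_ge3 : (3 <= n)%N.
Hypothesis off : forall y, ecoef 1 (rmult y (evec (n - 1)%N)) = 0.

(** Under [off], right multiplication by [y] is triangular; [wt1] and [wt2] are its diagonal entries
    at $e_1$ and $e_{n-1}$, which determine all the others. *)
Definition wt1 y : F := ecoef 1 (rmult y (evec 1%N)).
Definition wt2 y : F := ecoef (n - 1) (rmult y (evec (n - 1)%N)).

Lemma wt1P c y z : wt1 (c *: y + z) = c * wt1 y + wt1 z.
Proof. by rewrite /wt1 rmultP linearP. Qed.

Lemma wt2P c y z : wt2 (c *: y + z) = c * wt2 y + wt2 z.
Proof. by rewrite /wt2 rmultP linearP. Qed.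

Lemma rmult_triangular y i j : (1 <= i <= n)%N -> (1 <= j <= n)%N ->
  (rank n j <= rank n i)%N ->
  ecoef j (rmult y (evec i)) = weight n (wt1 y) (wt2 y) i *+ (j == i).
Proof.
by move=> iN jN rij; apply: (derivation_triangular n_ge3 (@derivation_rmult y)).
Qed.

Lemma rmult_lead y i u : (1 <= i <= n)%N -> in_flag (rank n) (rank n i) u ->
  ecoef i (rmult y u) = ecoef i u * weight n (wt1 y) (wt2 y) i.
Proof. exact: (triangular_lead (@rmult_triangular y)). Qed.

Lemma weight1 (p q : F) : weight n p q 1 = p.
Proof. by rewrite /weight ifT ?mul1r //; lia. Qed.

Lemma weightn1 (p q : F) : weight n p q (n - 1)%N = q.
Proof. by rewrite /weight ifF ?eqxx //; lia. Qed.

Lemma in_flag_en1 u : ecoef 1 u = 0 -> in_flag (rank n) (rank n (n - 1)) u.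
Proof.
move=> u1 j jn; rewrite {2}/rank eqxx /rank.
case: ifP => [|/negP jn1]; first by lia.
by case: ifP => [|/negP jnn] rj; [lia|have -> : j = 1%N by lia].
Qed.

Lemma in_flag_e1 u : in_flag (rank n) (rank n 1) u.
Proof.
move=> j jn; rewrite {2}/rank ifF ?ifF; [|lia..].
by rewrite /rank; do !case: ifP; lia.
Qed.

(** Diagonals of triangular maps multiply entrywise, so a commutator has zero diagonal. *)
Lemma wt_br y z : wt1 (br y z) = 0 /\ wt2 (br y z) = 0.
Proof.
rewrite /wt1 /wt2 !rmult_br !linearB /=; split.
  have n1 : (1 <= 1 <= n)%N by lia.
  by rewrite !(rmult_lead _ n1 (in_flag_e1 _)) !weight1; ring.
have nn : (1 <= n - 1 <= n)%N by lia.
rewrite (rmult_lead z nn (in_flag_en1 (off y))).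
by rewrite (rmult_lead y nn (in_flag_en1 (off z))) !weightn1 mulrC subrr.
Qed.

Lemma wt_f u : wt1 (f u) = 0 /\ wt2 (f u) = 0.
Proof.
rewrite /wt1 /wt2 !rmult_f !ecoef_M2 //; split.
  have -> : (1 == n)%N = false by lia.
  by rewrite !mulr0n addr0.
have -> : (n - 1 == n)%N = false by lia.
have -> : (1 < n - 1 <= n - 2)%N = false by lia.
by rewrite !mulr0n addr0.
Qed.

(** Bracketing with an element of zero weights pushes each step of the flag into the next, so the
    lower central series of [I] reaches 0 and the maximality of [N] applies. *)
Lemma weight0_ideal_sub_nilradical (I : {vspace L}) : nilradical br N ->
  ideal br I -> (brv br I I <= N)%VS ->
  (forall y, y \in I -> wt1 y = 0 /\ wt2 y = 0) -> (I <= N)%VS.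
Proof.
move=> [_ maxN] idI IIN wt0; apply: maxN; split=> //.
have LCS k : (lower_central_series br I k.+1 <= f @: flagv F n (rank n) k)%VS.
  elim: k => [|k IHk].
    apply/subvP => x /(subvP IIN)/memN[u ->]; apply: memv_img; apply/flagvP.
    by move=> j jn.
  rewrite [X in (X <= _)%VS]/(brv _ _ _); apply: brv_subv => x y.
  move=> /(subvP IHk)/memv_imgP[u /flagvP uk ->] yI; rewrite -f_rmult.
  apply/memv_img/flagvP => j jn rj; have [y1 y2] := wt0 y yI.
  rewrite rmult_lead //; last by apply: in_flagW uk; rewrite -ltnS.
  by rewrite y1 y2 /weight mulr0 addr0 !if_same mulr0.
(* All ranks are below [n.*2 + 5]; the extra step is the one that enters [N]. *)
exists (n.*2 + 5).+1; apply/eqP; rewrite -subv0; apply: subv_trans (LCS _) _.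
apply/subvP => _ /memv_imgP[u /flagvP uk ->]; suff -> : u = 0.
  by rewrite linear0 mem0v.
apply: ecoef_ext => j jn; rewrite linear0; apply: uk => //.
by rewrite /rank; do !case: ifP; lia.
Qed.

(** * The quotient $L/N$ as the plane of weights *)

Hypotheses (solL : solvable_algebra br) (dimL : \dim {:L} = (n + 2)%N).
Hypothesis radN : nilradical br N.

Definition wt_row y : 'rV[F]_2 := \row_j (if j == 0 then wt1 y else wt2 y).

Fact wt_row_is_linear : linear wt_row.
Proof.
by move=> c y z; apply/rowP=> j; rewrite !mxE wt1P wt2P; case: ifP.
Qed.

HB.instance Definition _ := GRing.isLinear.Build F L 'rV[F]_2 *:%R
  wt_row wt_row_is_linear.

Lemma wt_kerP y : reflect (wt1 y = 0 /\ wt2 y = 0) (y \in lker (linfun wt_row)).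
Proof.
rewrite memv_ker lfunE /=; apply: (iffP eqP) => [/rowP y0|[y1 y2]].
  by have := (y0 0, y0 1); rewrite !mxE /= => -[].
by apply/rowP=> j; rewrite !mxE y1 y2 if_same.
Qed.

Lemma N_sub_wt_ker : (N <= lker (linfun wt_row))%VS.
Proof. by apply/subvP => _ /memN[u ->]; apply/wt_kerP/wt_f. Qed.

(** The ideal $I=[L,L]+N$ has zero weights and $[I,I]\subseteq N$ by [solvable_derived2], so the
    previous criterion puts it inside [N]. *)
Lemma brN x y : br x y \in N.
Proof.
have [_] := solvable_derived2 idN solL (etrans dimL (congr1 (addn^~ 2) (esym dim_N))).
set I := (_ + N)%VS => IIN.
have LLI : (brv br fullv fullv <= I)%VS by apply: addvSl.
suff /subvP IN : (I <= N)%VS by apply/IN/(subvP LLI)/memv_brv; rewrite memvf.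
apply: weight0_ideal_sub_nilradical => // [|z].
  by split; apply: subv_trans LLI; apply: brvS; rewrite ?subvf.
suff /subvP/[apply]/wt_kerP : (I <= lker (linfun wt_row))%VS by [].
rewrite subv_add N_sub_wt_ker andbT; apply: brv_subv => z1 z2 _ _.
exact/wt_kerP/wt_br.
Qed.

(** The common kernel of the weights contains all brackets, so it is an ideal; by [brN] its brackets
    lie in [N], and the same criterion applies. *)
Lemma wt_ker : lker (linfun wt_row) = N.
Proof.
apply/eqP; rewrite eqEsubv N_sub_wt_ker andbT.
have brI U V : (brv br U V <= lker (linfun wt_row))%VS.
  by apply: brv_subv => z1 z2 _ _; apply/wt_kerP/wt_br.
apply: weight0_ideal_sub_nilradical => // [|y /wt_kerP//].
by apply: brv_subv => z1 z2 _ _; apply: brN.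
Qed.

Lemma wt_surj (p q : F) : exists y, wt1 y = p /\ wt2 y = q.
Proof.
have lim : limg (linfun wt_row) = fullv.
  apply/eqP; rewrite eqEdim subvf /= dimvf /dim /=.
  have := limg_ker_dim (linfun wt_row) fullv.
  by rewrite capfv wt_ker dim_N dimL; lia.
have : \row_j (if j == 0 then p else q) \in limg (linfun wt_row).
  by rewrite lim memvf.
move=> /memv_imgP[y _]; rewrite lfunE /= => /rowP yE; exists y.
by have := (yE 0, yE 1); rewrite !mxE /= => -[-> ->].
Qed.

(** * An eigenbasis of [N] for a regular element *)

Hypothesis char0 : forall k, (k%:R == 0 :> F) = (k == 0)%N.

Lemma natr_inj i j : i%:R = j%:R :> F -> i = j.
Proof.
wlog ij : i j / (i <= j)%N.
  by move=> W E; case/orP: (leq_total i j) => ij; [|apply/esym]; apply: W.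
move=> /eqP; rewrite eq_sym -subr_eq0 -natrB // char0 subn_eq0 => ji.
by apply/eqP; rewrite eqn_leq ij.
Qed.

(* For weight 1 of e_1 and n of e_(n-1) the weights 1, ..., n-2, n, n+1 of e_1,
   ..., e_n are distinct and nonzero. *)
Definition natw i := (i + (n - 1 <= i))%N.

Lemma weight_natw i : (1 <= i <= n)%N -> weight n 1 n%:R i = (natw i)%:R :> F.
Proof.
move=> iN; rewrite /weight /natw; case: ifP => i2.
  by rewrite mulr1; congr _%:R; lia.
case: ifP => [/eqP ->|/eqP i1]; first by congr _%:R; lia.
have -> : i = n by lia.
by rewrite -[1]/(1%:R) -natrD; congr _%:R; lia.
Qed.

Lemma natw_inj i j : (1 <= i <= n)%N -> (1 <= j <= n)%N ->
  natw i = natw j -> i = j.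
Proof. by rewrite /natw; lia. Qed.

Lemma rmult_regular x : wt1 x = 1 -> wt2 x = n%:R ->
  forall i j, (1 <= i <= n)%N -> (1 <= j <= n)%N -> (rank n j <= rank n i)%N ->
  ecoef j (rmult x (evec i)) = (natw i)%:R *+ (j == i).
Proof.
by move=> x1 x2 i j iN jN rij; rewrite rmult_triangular // x1 x2 weight_natw.
Qed.

Lemma eigenbasis_exists : exists x (v : nat -> 'rV[F]_n),
  [/\ wt1 x = 1, wt2 x = n%:R & forall i, (1 <= i <= n)%N ->
    [/\ rmult x (v i) = (natw i)%:R *: v i, in_flag (rank n) (rank n i) (v i)
       & ecoef i (v i) = 1]].
Proof.
have [x [x1 x2]] := wt_surj 1 n%:R; exists x.
(* Finite choice over ['I_n.+1]; the index 0 receives the dummy value 0. *)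
have /fin_all_exists[g gP] : forall i : 'I_n.+1, exists v, (1 <= i <= n)%N ->
    [/\ rmult x v = (natw i)%:R *: v, in_flag (rank n) (rank n i) v
       & ecoef i v = 1].
  move=> i; have [iN|iN] := boolP (1 <= i <= n)%N; last by exists 0.
  have neq j : (1 <= j <= n)%N -> j != i -> (natw j)%:R != (natw i)%:R :> F.
    by move=> jN; apply: contraNneq => /natr_inj/natw_inj ->.
  have [v vP] := eigenvector_exists (rank_inj n_ge3) (rmult_regular x1 x2) iN neq.
  by exists v.
exists (fun i => g (inord i)); split=> // i iN.
by have := gP (inord i); rewrite inordK ?ltnS; [apply|case/andP: iN].
Qed.

Variables (x : L) (v : nat -> 'rV[F]_n).
Hypotheses (x1 : wt1 x = 1) (x2 : wt2 x = n%:R).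
Hypothesis vP : forall i, (1 <= i <= n)%N ->
  [/\ rmult x (v i) = (natw i)%:R *: v i, in_flag (rank n) (rank n i) (v i)
     & ecoef i (v i) = 1].

Local Notation p i := (f (v i)).

Lemma rmult_eigen0 m u : rmult x u = m%:R *: u ->
  (forall i, (1 <= i <= n)%N -> natw i <> m) -> u = 0.
Proof.
move=> xu mP; apply: (eigenvector_eq0 (rmult_regular x1 x2) xu) => i iN.
by move=> /natr_inj /(mP i iN).
Qed.

Lemma rmult_eigen i u : (1 <= i <= n)%N -> rmult x u = (natw i)%:R *: u ->
  u = ecoef i u *: v i.
Proof.
move=> iN xu; have [xvi _ vi] := vP iN; apply/subr0_eq.
apply: (@eigenvector_eq0 _ _ _ _ _ (rmult_regular x1 x2) (natw i)%:R).
  by rewrite linearB linearZ /= xu xvi scalerBr !scalerA mulrC.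
move=> j jN /natr_inj/natw_inj -> //.
by rewrite linearB linearZ /= vi mulr1 subrr.
Qed.

(** A derivation adds eigenvalues. Hence a product of eigenvectors spans the eigenline of the sum of
    their weights, or is zero; the lemmas below read the scalar off one coordinate. *)
Lemma eigen_M2 i j : (1 <= i <= n)%N -> (1 <= j <= n)%N ->
  rmult x (M2 n lam (v i) (v j)) = (natw i + natw j)%:R *: M2 n lam (v i) (v j).
Proof.
move=> iN jN; rewrite derivation_rmult.
have [-> _ _] := vP iN; have [-> _ _] := vP jN.
by rewrite linearZl_LR linearZr_LR /= -scalerDl -natrD.
Qed.

Lemma ecoef_v i j : (1 <= i <= n)%N -> (1 <= j <= n)%N ->
  (rank n j < rank n i)%N -> ecoef j (v i) = 0.
Proof. by move=> iN jN rij; have [_ + _] := vP iN; apply. Qed.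

Lemma ecoef1_v i : (2 <= i <= n)%N -> ecoef 1 (v i) = 0.
Proof.
move=> iN; apply: ecoef_v; [lia|lia|].
by rewrite /rank; do !case: ifP; lia.
Qed.

Lemma ecoefn1_v i : (2 <= i <= n)%N -> i != (n - 1)%N -> ecoef (n - 1) (v i) = 0.
Proof.
move=> iN; move=> ni; apply: ecoef_v; [lia|lia|].
by rewrite /rank; do !case: ifP; lia.
Qed.

Lemma v1_1 : ecoef 1 (v 1%N) = 1.
Proof.
have n1 : (1 <= 1 <= n)%N by lia.
by have [_ _ ->] := vP n1.
Qed.

Lemma vn1_n1 : ecoef (n - 1) (v (n - 1)%N) = 1.
Proof.
have nn : (1 <= n - 1 <= n)%N by lia.
by have [_ _ ->] := vP nn.
Qed.

Lemma br_next i : (1 <= i <= n - 3)%N -> br (p i) (p 1%N) = p i.+1.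
Proof.
move=> iN; rewrite -f_morph; congr (f _).
rewrite [LHS](@rmult_eigen i.+1); last 2 first; [lia| |].
  rewrite eigen_M2; [|lia..]; congr (_%:R *: _); rewrite /natw; lia.
have -> : ecoef i.+1 (M2 n lam (v i) (v 1%N)) = 1; last by rewrite scale1r.
have iN' : (1 <= i <= n)%N by lia.
have [_ _ vi] := vP iN'; rewrite ecoef_M2 // vi v1_1.
have -> : (1 < i.+1 <= n - 2)%N by lia.
have -> : (i.+1 == n) = false by lia.
by rewrite mulr0n mulr1 addr0.
Qed.

Lemma br_n1_1 : br (p (n - 1)%N) (p 1%N) = p n.
Proof.
rewrite -f_morph; congr (f _).
rewrite [LHS](@rmult_eigen n); last 2 first; [lia| |].
  rewrite eigen_M2; [|lia..]; congr (_%:R *: _); rewrite /natw; lia.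
have -> : ecoef n (M2 n lam (v (n - 1)%N) (v 1%N)) = 1; last by rewrite scale1r.
rewrite ecoef_M2 // vn1_n1 v1_1 (@ecoef1_v (n - 1)); last by lia.
have -> : (1 < n <= n - 2)%N = false by lia.
by rewrite eqxx mulr0n mulr1n; ring.
Qed.

Lemma br_1_n1 : br (p 1%N) (p (n - 1)%N) = lam *: p n.
Proof.
rewrite -f_morph -linearZ; congr (f _).
rewrite [LHS](@rmult_eigen n); last 2 first; [lia| |].
  rewrite eigen_M2; [|lia..]; congr (_%:R *: _); rewrite /natw; lia.
congr (_ *: _); rewrite ecoef_M2 // vn1_n1 v1_1 (@ecoef1_v (n - 1)); last by lia.
have -> : (1 < n <= n - 2)%N = false by lia.
by rewrite eqxx mulr0n mulr1n; ring.
Qed.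

(** The product would have weight $n-1$ or $n+2$, neither of which is an eigenvalue on [N]. *)
Lemma br_end i : i = (n - 2)%N \/ i = n -> br (p i) (p 1%N) = 0.
Proof.
move=> iE; have iN : (1 <= i <= n)%N by lia.
rewrite -f_morph (rmult_eigen0 (eigen_M2 iN _)) ?linear0 //; first by lia.
by move=> j jN; rewrite /natw; lia.
Qed.

(** Sums of weights may again be weights, so coordinates are used: the bracket sees [v j] only
    through its $e_1$ coordinate, which is 0, and its $e_{n-1}$ coordinate, which is multiplied by
    the $e_1$ coordinate of [v i]. *)
Lemma br_zero i j : (1 <= i <= n)%N -> (2 <= j <= n)%N ->
  ~~ ((i == 1) && (j == n - 1))%N -> br (p i) (p j) = 0.
Proof.
move=> iN jN ij; rewrite -f_morph.
suff -> : M2 n lam (v i) (v j) = 0 by rewrite linear0.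
apply: ecoef_ext => k kn; rewrite linear0 ecoef_M2 // ecoef1_v // !mulr0 add0r.
have [i1|i1] := eqVneq i 1%N; last first.
  by rewrite (@ecoef1_v i) ?mulr0 ?mul0r ?mul0rn ?addr0 //; lia.
by rewrite (@ecoefn1_v j) ?mulr0 ?mul0rn ?addr0 //; move: ij; rewrite i1.
Qed.

Lemma p_neq0 i : (1 <= i <= n)%N -> p i != 0.
Proof.
move=> iN; have [_ _ vi] := vP iN; apply/eqP; rewrite -[0](linear0 f).
move=> /f_inj v0; have := oner_neq0 F.
by rewrite -vi v0 linear0 eqxx.
Qed.

(** Right multiplication by [x] has no eigenvalue 0 on [N], hence is onto [N]; so [y] can be
    corrected by an element of [N], which has zero weights, until it is killed by [x]. *)
Lemma torus_exists (s t : F) : exists h, [/\ wt1 h = s, wt2 h = t & br h x = 0].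
Proof.
have [y [y1 y2]] := wt_surj s t.
have [w yx] := memN (brN y x).
have ker0 : lker (rmult x) == 0%VS.
  rewrite -subv0; apply/subvP => u; rewrite memv_ker => /eqP xu.
  rewrite memv0; apply/eqP; apply: (@rmult_eigen0 0); first by rewrite xu scale0r.
  by move=> i iN; rewrite /natw; lia.
have : w \in limg (rmult x) by rewrite lker0_limgf ?memvf.
move=> /memv_imgP[m _ wE]; exists (- 1 *: f m + y).
have [m1 m2] := wt_f m; rewrite wt1P wt2P m1 m2 !mulr0 !add0r; split=> //.
by rewrite linearPl /= yx wE f_rmult scaleN1r addNr.
Qed.

(** The substitute for antisymmetry: $[y,z]+[z,y]$ lies in the right annihilator. It ties left
    weights to right weights. *)
Lemma br_symm (u y z : L) : br u (br y z) + br u (br z y) = 0.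
Proof. by rewrite !leib -[X in _ + X]opprB addrN. Qed.

(** * Left and right weights of the complement of [N] *)

Section Torus.
Variable h : L.
Hypothesis hx : br h x = 0.

(** As $[h,x]=0$, right multiplications by [h] and [x] commute on [N], so [h] preserves the
    eigenlines of [x]; the leading coordinate gives the eigenvalue. *)
Lemma br_p_torus i : (1 <= i <= n)%N ->
  br (p i) h = weight n (wt1 h) (wt2 h) i *: p i.
Proof.
move=> iN; have [xvi vif vi] := vP iN.
rewrite -f_rmult -linearZ; congr (f _); rewrite [LHS](@rmult_eigen i) //.
  by rewrite rmult_lead // vi mul1r.
apply: f_inj; rewrite linearZ /= !f_rmult; have := leib (p i) h x.
rewrite hx linear0r => /esym/subr0_eq ->.
by rewrite -f_rmult xvi linearZ /= linearZl_LR.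
Qed.

(** With $[h,x]=0$ the Leibniz identity becomes $[h,[p_i,x]]=[[h,p_i],x]$, which keeps $[h,p_i]$ in
    the eigenline of $p_i$. *)
Lemma br_torus_p i : (1 <= i <= n)%N -> exists c, br h (p i) = c *: p i.
Proof.
move=> iN; have [xvi vif vi] := vP iN.
have [u hp] := memN (brN h (p i)); exists (ecoef i u).
rewrite hp -linearZ; congr (f _); apply: rmult_eigen => //.
apply: f_inj; rewrite linearZ /= f_rmult -hp.
have := leib h (p i) x; rewrite hx linear0l subr0 => <-.
by rewrite -f_rmult xvi linearZ /= linearZr_LR.
Qed.

(** The bracket lies in [N] and is killed by [x], which has no eigenvalue 0 there. *)
Lemma br_torus h' : br h' x = 0 -> br h h' = 0.
Proof.
move=> h'x; have [u hh] := memN (brN h h'); 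
  rewrite hh (@rmult_eigen0 0 u) ?linear0 //.
  rewrite scale0r; apply: f_inj; rewrite linear0 f_rmult -hh.
  have := leib h h' x.
  by rewrite hx h'x linear0r linear0l subr0.
by move=> i iN; rewrite /natw; lia.
Qed.

(** By [br_symm], $[p_{n-1},-]$ kills $[h,p_1]+[p_1,h]$, a multiple of $p_1$, whereas
    $[p_{n-1},p_1]=p_n$ is nonzero. *)
Lemma br_torus_1 : br h (p 1%N) = - wt1 h *: p 1%N.
Proof.
have n1 : (1 <= 1 <= n)%N by lia.
have nn : (1 <= n <= n)%N by lia.
have [c hp] := br_torus_p n1; rewrite hp; congr (_ *: _); apply/eqP.
have := br_symm (p (n - 1)%N) h (p 1%N); rewrite hp br_p_torus // weight1.
rewrite !linearZr_LR /= br_n1_1 -scalerDl => /eqP.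
by rewrite scaler_eq0 (negbTE (p_neq0 nn)) orbF addr_eq0.
Qed.

Lemma br_torus_mid i : (2 <= i <= n - 2)%N -> br h (p i) = 0.
Proof.
elim: i => // -[//|[_ iN|i IHi iN]].
  have i1 : (1 <= 1 <= n - 3)%N by lia.
  by rewrite -(br_next i1) leib br_torus_1 subrr.
rewrite -br_next ?leib ?br_torus_1 ?IHi ?linear0l; [|lia..].
rewrite linearZl_LR /= br_zero ?scaler0 ?subr0 //; lia.
Qed.

(** The action on $p_n$ follows from $p_n=[p_{n-1},p_1]$. Computing it again from $\lambda
    p_n=[p_1,p_{n-1}]$ gives the last relation, and [br_symm] at $p_1$ fixes [d] when $\lambda\ne
    0$. *)
Lemma br_torus_n1 : exists d,
  [/\ br h (p (n - 1)%N) = d *: p (n - 1)%N,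
      br h (p n) = (d + wt1 h * lam) *: p n,
      lam != 0 -> d = - wt2 h & (1 + lam) * (d + wt1 h * lam) = 0].
Proof.
have nn1 : (1 <= n - 1 <= n)%N by lia.
have nn : (1 <= n <= n)%N by lia.
have [d hp] := br_torus_p nn1; exists d.
have hpn : br h (p n) = (d + wt1 h * lam) *: p n.
  rewrite -br_n1_1 leib hp br_torus_1 !linearZl_LR /= br_n1_1 br_1_n1.
  by rewrite scaleNr opprK scalerA -scalerDl.
split=> // [lam0|].
  have := br_symm (p 1%N) h (p (n - 1)%N); rewrite hp br_p_torus // weightn1.
  rewrite !linearZr_LR /= br_1_n1 -scalerDl scalerA => /eqP.
  rewrite scaler_eq0 (negbTE (p_neq0 nn)) orbF mulf_eq0 (negbTE lam0) orbF.
  by rewrite addr_eq0 => /eqP.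
have : br h (lam *: p n) = (- wt1 h * lam - d) *: p n.
  rewrite -br_1_n1 leib hp br_torus_1 !linearZl_LR /= br_n1_1 br_1_n1.
  by rewrite scalerA -scalerBl.
rewrite linearZr_LR /= hpn scalerA => /eqP; rewrite -subr_eq0 -scalerBl.
rewrite scaler_eq0 (negbTE (p_neq0 nn)) orbF => /eqP <-; ring.
Qed.
End Torus.

(** * Structure constants in an adapted basis *)

Section TorusBasis.
Variables h1 h2 : L.
Hypotheses (h1_1 : wt1 h1 = 1) (h1_2 : wt2 h1 = 0) (h1x : br h1 x = 0).
Hypotheses (h2_1 : wt1 h2 = 0) (h2_2 : wt2 h2 = 1) (h2x : br h2 x = 0).

Definition adapted_basis i : L :=
  if (i <= n)%N then p i else if i == n.+1 then h1 else h2.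

(** The two weights isolate the coefficients of [h1] and [h2]; the remaining family is
    unitriangular. *)
Lemma adapted_basis_free (a : nat -> F) :
  \sum_(i < n + 2) a i.+1 *: adapted_basis i.+1 = 0 ->
  forall i, (1 <= i <= n + 2)%N -> a i = 0.
Proof.
rewrite big_split_ord /= !big_ord_recl big_ord0 addr0 /= !addn0.
rewrite (eq_bigr (fun i : 'I_n => f (a i.+1 *: v i.+1))) => [|i _]; last first.
  by rewrite /adapted_basis ltn_ord linearZ.
rewrite -linear_sum /= /adapted_basis.
have -> : (n < n)%N = false by lia.
have -> : (n + bump 0 0 < n)%N = false by lia.
have -> : ((n + bump 0 0).+1 == n.+1) = false by rewrite /bump; lia.
rewrite eqxx /bump /= addn0 addn1; set w := \sum_(i < n) _ => s0.
have {}s0 : a n.+1 *: h1 + (a n.+2 *: h2 + f w) = 0.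
  by rewrite addrA addrC.
have [w1 w2] := wt_f w.
have wt0 : wt1 0 = 0 /\ wt2 0 = 0 by have := wt_f 0; rewrite linear0.
have := congr1 wt1 s0; have := congr1 wt2 s0; rewrite !(wt1P, wt2P).
rewrite w1 w2 wt0.1 wt0.2 h1_1 h1_2 h2_1 h2_2 !(mulr0, mulr1, addr0, add0r).
move=> a2 a1; move: s0; rewrite a1 a2 !scale0r !add0r -(linear0 f) => /f_inj w0.
have an : forall i, (1 <= i <= n)%N -> a i = 0.
  apply: (triangular_free (rank_inj n_ge3) (v := v)) => // i iN.
  by have [] := vP iN.
move=> i iN; have [iN'|iN'] := boolP (i <= n)%N; first by apply: an; lia.
by have [->|->] : i = n.+1 \/ i = n.+2 by lia.
Qed.

Local Notation g := adapted_basis.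

Lemma adapted_basis_N i : (i <= n)%N -> g i = p i.
Proof. by rewrite /g => ->. Qed.

Lemma adapted_basis_n1 : g (n + 1)%N = h1.
Proof. by rewrite /g addn1 ltnn eqxx. Qed.

Lemma adapted_basis_n2 : g (n + 2)%N = h2.
Proof. by rewrite /g addn2 ifF ?ifF //; lia. Qed.

Lemma M2_table_adapted i j : (1 <= i <= n)%N -> (1 <= j <= n)%N ->
  basis_map g (M2_table (n + 2) n lam i j) = br (g i) (g j).
Proof.
move=> iN jN; rewrite !adapted_basis_N; [|lia..].
rewrite /M2_table; case: ifP => [/andP[i1 /eqP ->]|ij1].
  by rewrite basis_map_evec ?br_next ?adapted_basis_N //; lia.
case: ifP => [/andP[/eqP -> /eqP ->]|ij2].
  by rewrite basis_map_evec ?br_n1_1 ?adapted_basis_N //; lia.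
case: ifP => [/andP[/eqP -> /eqP ->]|ij3].
  by rewrite linearZ /= basis_map_evec ?br_1_n1 ?adapted_basis_N //; lia.
rewrite linear0; have [j1|j1] := eqVneq j 1%N.
  by rewrite j1 br_end //; lia.
by rewrite br_zero //; lia.
Qed.

(** The products in [N], the right action of [h1] and [h2] and their mutual brackets are settled
    already, so matching a table comes down to the left weights [l1] and [l2]. *)
Lemma adapted_basis_isomorphic (c : nat -> nat -> 'rV[F]_(n + 2))
    (l1 l2 : nat -> F) :
  (forall i j, (1 <= i <= n)%N -> (1 <= j <= n)%N ->
    c i j = M2_table (n + 2) n lam i j) ->
  (forall i, (1 <= i <= n)%N -> c i (n + 1)%N = weight n 1 0 i *: evec i) ->
  (forall i, (1 <= i <= n)%N -> c i (n + 2)%N = weight n 0 1 i *: evec i) ->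
  (forall j, (1 <= j <= n)%N -> c (n + 1)%N j = l1 j *: evec j) ->
  (forall j, (1 <= j <= n)%N -> c (n + 2)%N j = l2 j *: evec j) ->
  (forall i j, (n < i)%N -> (n < j)%N -> c i j = 0) ->
  (forall j, (1 <= j <= n)%N -> br h1 (p j) = l1 j *: p j) ->
  (forall j, (1 <= j <= n)%N -> br h2 (p j) = l2 j *: p j) ->
  isomorphic (table_bracket c) br.
Proof.
move=> cM2 cr1 cr2 cl1 cl2 c0 h1p h2p.
have top k : (n < k)%N -> (1 <= k <= n + 2)%N -> k = (n + 1)%N \/ k = (n + 2)%N.
  by lia.
have mapP k a : (1 <= k <= n)%N ->
    basis_map g (a *: evec k : 'rV_(n + 2)) = a *: p k.
  move=> kN; rewrite linearZ /= basis_map_evec; last by lia.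
  by rewrite adapted_basis_N //; lia.
exists (linfun (basis_map g)).
apply: (basis_map_isomorphism dimL adapted_basis_free) => i j iN jN.
have [i_n|i_n] := leqP i n; have [j_n|j_n] := leqP j n.
- by rewrite cM2 ?M2_table_adapted //; lia.
- have i_n' : (1 <= i <= n)%N by lia.
  have [->|->] := top j j_n jN; rewrite ?cr1 ?cr2 // mapP //.
    by rewrite adapted_basis_n1 adapted_basis_N // br_p_torus // h1_1 h1_2.
  by rewrite adapted_basis_n2 adapted_basis_N // br_p_torus // h2_1 h2_2.
- have j_n' : (1 <= j <= n)%N by lia.
  have [->|->] := top i i_n iN; rewrite ?cl1 ?cl2 // mapP //.
    by rewrite adapted_basis_n1 adapted_basis_N // h1p.
  by rewrite adapted_basis_n2 adapted_basis_N // h2p.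
- rewrite c0 // linear0; apply/esym.
  have gx k : (n < k)%N -> (1 <= k <= n + 2)%N -> br (g k) x = 0.
    move=> kn kN; have [->|->] := top k kn kN.
      by rewrite adapted_basis_n1.
    by rewrite adapted_basis_n2.
  by apply: br_torus; apply: gx.
Qed.

Ltac table_cases :=
  rewrite /R20_table /R2m1_table /M2_table /weight; do !case: ifP => ?;
  rewrite ?scale0r ?mulr0 ?mulr1 ?addr0 ?add0r ?oppr0 ?scale0r ?scaleNr ?scale1r;
  try by [|lia].

Lemma R20_isomorphic : lam = 0 -> isomorphic (R20 F n) br.
Proof.
move=> lam0; have left h : br h x = 0 ->
    forall j, (1 <= j <= n)%N ->
    br h (p j) = (if j == 1%N then - wt1 h else 0) *: p j.
  move=> hx j jn; case: eqP => [->|j1]; first exact: br_torus_1.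
  rewrite scale0r; have [d [hn1 hn _]] := br_torus_n1 hx.
  (* For $\lambda=0$ the last relation of [br_torus_n1] reads $d=0$. *)
  rewrite lam0 mulr0 !addr0 mul1r in hn * => d0.
  have [j2|[->|->]] : (2 <= j <= n - 2)%N \/ j = (n - 1)%N \/ j = n by lia.
  - exact: br_torus_mid.
  - by rewrite hn1 d0 scale0r.
  - by rewrite hn d0 scale0r.
apply: (adapted_basis_isomorphic _ _ _ _ _ _ (left _ h1x) (left _ h2x)).
- by move=> i j iN jN; rewrite lam0; table_cases.
- by move=> i iN; table_cases; congr evec; lia.
- by move=> i iN; table_cases; congr evec; lia.
- by move=> j jN; rewrite h1_1; table_cases; congr (- evec _); lia.
- by move=> j jN; rewrite h2_1; table_cases.
- by move=> i j iN jN; table_cases.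
Qed.

Lemma R2m1_isomorphic : lam = -1 -> isomorphic (R2m1 F n) br.
Proof.
move=> lamN1; have lam0 : lam != 0 by rewrite lamN1 oppr_eq0 oner_neq0.
have left h : br h x = 0 -> forall j, (1 <= j <= n)%N ->
    br h (p j) = (if j == 1%N then - wt1 h else if (j <= n - 2)%N then 0
      else if j == (n - 1)%N then - wt2 h else - (wt1 h + wt2 h)) *: p j.
  move=> hx j jn; case: eqP => [->|j1]; first exact: br_torus_1.
  have [d [hn1 hn /(_ lam0) dE _]] := br_torus_n1 hx.
  case: ifP => j2; first by rewrite scale0r br_torus_mid //; lia.
  case: ifP => [/eqP ->|/eqP jn1]; first by rewrite hn1 dE.
  have -> : j = n by lia.
  by rewrite hn dE lamN1; congr (_ *: _); ring.
apply: (adapted_basis_isomorphic _ _ _ _ _ _ (left _ h1x) (left _ h2x)).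
- by move=> i j iN jN; rewrite lamN1; table_cases.
- by move=> i iN; table_cases; congr evec; lia.
- by move=> i iN; table_cases; congr evec; lia.
- by move=> j jN; rewrite h1_1 h1_2; table_cases; congr (- evec _); lia.
- by move=> j jN; rewrite h2_1 h2_2; table_cases; congr (- evec _); lia.
- by move=> i j iN jN; table_cases.
Qed.

End TorusBasis.

(** For an [h] of weights (0, 1) the relation of [br_torus_n1] is $(1+\lambda)d=0$, and $d=-1$ as
    soon as $\lambda\ne 0$. *)
Lemma lam_cases : lam = 0 \/ lam = -1.
Proof.
have [h [h1 h2 hx]] := torus_exists 0 1.
have [d [_ _ lamd lam1]] := br_torus_n1 hx.
have [|/lamd dE] := eqVneq lam 0; [by left|right; apply/eqP].
move: lam1; rewrite dE h1 h2 mul0r addr0 => /eqP.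
by rewrite mulf_eq0 oppr_eq0 oner_eq0 orbF addrC addr_eq0.
Qed.

Lemma eigenbasis_isomorphic :
  isomorphic (R20 F n) br \/ isomorphic (R2m1 F n) br.
Proof.
have [h1 [h11 h12 h1x]] := torus_exists 1 0.
have [h2 [h21 h22 h2x]] := torus_exists 0 1.
case: lam_cases => lamE; [left|right].
  exact: (@R20_isomorphic h1 h2).
exact: (@R2m1_isomorphic h1 h2).
Qed.

End RightMultiplication.

(** Triangularity is kept as a hypothesis on [f], so that the Heisenberg case can supply another
    frame. *)
Lemma triangular_isomorphic (F : fieldType) (n : nat) (lam : F)
    (L : vectType F) (br : {bilinear L -> L -> L}) (N : {vspace L})
    (f : 'Hom('rV[F]_n, L)) :
  (3 <= n)%N -> (forall k, (k%:R == 0 :> F) = (k == 0)%N) ->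
  leibniz_identity br -> solvable_algebra br -> \dim {:L} = (n + 2)%N ->
  nilradical br N -> lker f = 0%VS -> limg f = N ->
  (forall u v, f (M2 n lam u v) = br (f u) (f v)) ->
  (forall y, ecoef 1 (rmult br f y (evec (n - 1)%N)) = 0) ->
  isomorphic (R20 F n) br \/ isomorphic (R2m1 F n) br.
Proof.
move=> n3 char0 leib solL dimL radN kerf imf fM off.
have idN : ideal br N by case: radN => -[].
have [x [v [x1 x2 vP]]] :=
  eigenbasis_exists leib idN kerf imf fM n3 off solL dimL radN char0.
exact: (eigenbasis_isomorphic leib idN kerf imf fM n3 off solL dimL radN char0
  x1 x2 vP).
Qed.

(** * Coordinates of products given by a table *)

Section TableBracket.
Variables (F : fieldType) (N : nat) (c : nat -> nat -> 'rV[F]_N).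
Implicit Types u w : 'rV[F]_N.

Lemma table_bracket_evecl i u : (1 <= i <= N)%N ->
  table_bracket c (evec i) u = \sum_(j < N) ecoef j.+1 u *: c i j.+1.
Proof.
move=> iN; rewrite {1}(sum_evec u) linear_sumr /=; apply: eq_bigr => j _.
by rewrite linearZr_LR /= table_bracketE // ltn_ord.
Qed.

Lemma table_bracket_evecr j u : (1 <= j <= N)%N ->
  table_bracket c u (evec j) = \sum_(i < N) ecoef i.+1 u *: c i.+1 j.
Proof.
move=> jN; rewrite {1}(sum_evec u) linear_sumlz /=; apply: eq_bigr => i _.
by rewrite linearZl_LR /= table_bracketE // ltn_ord.
Qed.

Lemma ecoef_table_evecl m i k s u : (1 <= i <= N)%N ->
  (forall j, (1 <= j <= N)%N -> ecoef m (c i j) = s * (j == k)%:R) ->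
  ecoef m (table_bracket c (evec i) u) = s * ecoef k u.
Proof.
move=> iN cE; rewrite table_bracket_evecl // linear_sum -(sum_ecoef_eq k) mulr_sumr.
by apply: eq_bigr => j _; rewrite linearZ /= cE ?ltn_ord // mulrCA.
Qed.

End TableBracket.

(** * The two algebras are not isomorphic *)

Section NonIsomorphic.
Variables (F : fieldType) (n : nat).
Hypothesis n_ge3 : (3 <= n)%N.
Hypothesis char0 : forall k, (k%:R == 0 :> F) = (k == 0)%N.
Implicit Types u w : 'rV[F]_(n + 2).

Lemma ecoef_evec_eq k : (1 <= k <= n + 2)%N ->
  ecoef k (evec k : 'rV[F]_(n + 2)) = 1.
Proof. by move=> kN; rewrite ecoef_evec // eqxx. Qed.

Lemma ecoef_evec_neq m k : m != k -> (1 <= k <= n + 2)%N ->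
  ecoef m (evec k : 'rV[F]_(n + 2)) = 0.
Proof. by move=> mk kN; rewrite ecoef_evec // (negbTE mk). Qed.

Ltac solve_table :=
  rewrite /R2m1_table /M2_table; do !case: ifP => ?; try lia;
  rewrite ?linearN ?linearZ ?linear0 /=;
  try case: eqP => ?; try lia; rewrite ?mulr1 ?mulr0;
  rewrite ?ecoef_evec_eq ?ecoef_evec_neq ?oppr0 ?mulr1 ?mulr0 //; lia.

(** One product detects each coordinate: left factors $x_1,x_2,x_1,e_1,e_{n-1}$ detect those at
    $e_1,e_{n-1},e_n,x_1,x_2$ respectively. *)
Lemma R2m1_right_annihilator u : (forall w, R2m1 F n w u = 0) ->
  forall k, (1 <= k <= n + 2)%N -> ~~ (2 <= k <= n - 2)%N -> ecoef k u = 0.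
Proof.
move=> u_ann; have coef0 m i k (s : F) : (1 <= i <= n + 2)%N -> s != 0 ->
    (forall j, (1 <= j <= n + 2)%N ->
      ecoef m (R2m1_table F n i j) = s * (j == k)%:R) -> ecoef k u = 0.
  move=> iN s0 cE; have := ecoef_table_evecl u iN cE.
  have /= -> := u_ann (evec i); rewrite linear0 => /esym/eqP.
  by rewrite mulf_eq0 (negbTE s0) => /eqP.
have N1 : -1 != 0 :> F by rewrite oppr_eq0 oner_neq0.
have N1' : 1 != 0 :> F by rewrite oner_neq0.
move=> k kN k2.
have [->|[->|[->|[->|->]]]] : k = 1%N \/ k = (n - 1)%N \/ k = n \/
    k = (n + 1)%N \/ k = (n + 2)%N by lia.
- apply: (coef0 1%N (n + 1)%N 1%N (-1)) => // [|j jN]; first by lia.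
  by solve_table.
- apply: (coef0 (n - 1)%N (n + 2)%N (n - 1)%N (-1)) => // [|j jN]; first by lia.
  by solve_table.
- apply: (coef0 n (n + 1)%N n (-1)) => // [|j jN]; first by lia.
  by solve_table.
- apply: (coef0 1%N 1%N (n + 1)%N 1) => // [|j jN]; first by lia.
  by solve_table.
- apply: (coef0 (n - 1)%N (n - 1)%N (n + 2)%N 1) => // [|j jN]; first by lia.
  by solve_table.
Qed.

(** On the span of $e_2,\dots,e_{n-2}$, right multiplication by [w] is triangular, with diagonal
    entry at $e_k$ equal to $k$ times the $x_1$ coordinate of [w]; leading coordinates are
    compared. *)
Lemma R2m1_weight_eq0 u w (s : F) :
  (forall k, (1 <= k <= n + 2)%N -> ~~ (2 <= k <= n - 2)%N -> ecoef k u = 0) ->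
  R2m1 F n u w = s *: u ->
  (forall k, (2 <= k <= n - 2)%N -> s != k%:R * ecoef (n + 1) w) -> u = 0.
Proof.
move=> u_out uw s_neq.
apply: (@in_flag_ind _ _ id) => k kN uf.
have [k2|] := boolP (2 <= k <= n - 2)%N; last exact: u_out.
have uwk : ecoef k (R2m1 F n u w) = k%:R * ecoef (n + 1) w * ecoef k u.
  rewrite {1}(sum_evec u) linear_sumlz linear_sum /=.
  case: k kN k2 uf => // k kN k2 uf.
  rewrite (bigD1 (Ordinal (kN : (k < n + 2)%N))) //= linearZl_LR linearZ /=.
  rewrite (@ecoef_table_evecl _ _ _ _ _ (n + 1)%N k.+1%:R) // => [|j jN]; last first.
    by solve_table.
  rewrite big1 ?addr0 1?mulrC // => i; rewrite -val_eqE /= => ik.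
  rewrite linearZl_LR linearZ /=; case: (ltnP i k) => [ik'|ki].
    by rewrite uf ?mul0r // ltn_ord.
  have iN : (1 <= i.+1 <= n + 2)%N by rewrite ltn_ord.
  have [i2|i2] := boolP (2 <= i.+1 <= n - 2)%N; last by rewrite u_out // mul0r.
  rewrite (@ecoef_table_evecl _ _ _ _ _ 1 0) // => [|j jN]; last first.
    by rewrite mul0r; solve_table.
  by rewrite mul0r mulr0.
have := congr1 (ecoef k) uw; rewrite uwk linearZ /= => /eqP.
rewrite eq_sym -subr_eq0 -mulrBl mulf_eq0 subr_eq0 (negbTE (s_neq k k2)).
by move=> /eqP.
Qed.

Lemma R20_right_annihilator j w : j = (n - 1)%N \/ j = n ->
  R20 F n w (evec j) = 0.
Proof.
move=> jE; rewrite [LHS]table_bracket_evecr; last by lia.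
apply: big1 => i _; rewrite /R20_table /M2_table.
by do !case: ifP => ?; rewrite ?scale0r ?scaler0 //; lia.
Qed.

Lemma R20_not_isomorphic_R2m1 : ~ isomorphic (R20 F n) (R2m1 F n).
Proof.
case=> f [kerf imf fM].
have f_inj : injective f by apply/lker0P; rewrite kerf.
have neq0 k : (1 <= k <= n + 2)%N -> f (evec k) != 0.
  move=> kN; apply/eqP; rewrite -(linear0 f) => /f_inj/(congr1 (ecoef k)).
  by rewrite ecoef_evec // eqxx linear0 => /eqP; rewrite oner_eq0.
have f_out j : j = (n - 1)%N \/ j = n -> forall k, (1 <= k <= n + 2)%N ->
    ~~ (2 <= k <= n - 2)%N -> ecoef k (f (evec j)) = 0.
  move=> jE; apply: R2m1_right_annihilator => w.
  have : w \in limg f by rewrite imf memvf.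
  by move=> /memv_imgP[w' _ ->]; rewrite -fM R20_right_annihilator ?linear0.
pose x1 := f (evec (n + 1)%N).
have nx : R2m1 F n (f (evec (n - 1)%N)) x1 = 0 *: f (evec (n - 1)%N).
  rewrite -fM /R20 /= table_bracketE; [|lia..].
  by rewrite scale0r; apply/eqP; rewrite /R20_table /M2_table; do !case: ifP => ?;
    rewrite ?linear0 //; lia.
have x1n : R2m1 F n (f (evec n)) x1 = 1 *: f (evec n).
  rewrite -fM /R20 /= table_bracketE; [|lia..].
  by rewrite scale1r; congr (f _); rewrite /R20_table; do !case: ifP => ? //; lia.
(* The images of $e_{n-1}$ and $e_n$ have eigenvalues 0 and 1 under [x1]. If its $x_1$ coordinate is
   0, the eigenvalue 1 is impossible; otherwise 0 is. *)
have [x0|x0] := eqVneq (ecoef (n + 1) x1) 0.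
  have nN : (1 <= n <= n + 2)%N by lia.
  have /eqP := neq0 n nN; apply; apply: R2m1_weight_eq0 x1n _.
    by apply: f_out; right.
  by move=> k kN; rewrite x0 mulr0 oner_neq0.
have nN : (1 <= n - 1 <= n + 2)%N by lia.
have /eqP := neq0 _ nN; apply; apply: R2m1_weight_eq0 nx _.
  by apply: f_out; left.
move=> k kN; rewrite eq_sym mulf_neq0 // char0; lia.
Qed.
End NonIsomorphic.

(* If A B - B A is a nonzero multiple of A then A is nilpotent, and its kernel
   is stable under B. *)
Lemma common_eigenvector_mx2 (C : numClosedFieldType) (A B : 'M[C]_2) (c : C) :
  A *m B - B *m A = c *: A ->
  exists2 v : 'rV_2, v != 0 & stablemx v A && stablemx v B.
Proof.
move=> AB; have [AB0|AB0] := eqVneq (c *: A) 0.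
  by apply: common_eigenvector2 => //; apply/subr0_eq; rewrite AB.
have [c0 A0] : c != 0 /\ A != 0.
  by move: AB0; rewrite scaler_eq0 negb_or => /andP[].
have kerA : kermx A != 0.
  rewrite kermx_eq0 row_free_unit; apply/negP=> uA.
  (* If [A] were invertible, the trace of $(AB-BA)A^{-1}=c\cdot 1$ would be both 0 and $2c$. *)
  have := congr1 (fun M => \tr (M *m invmx A)) AB.
  rewrite mulmxBl linearB /= (mxtrace_mulC (A *m B)) mulmxA mulVmx // mul1mx.
  rewrite -(mulmxA B) mulmxV // mulmx1 subrr -scalemxAl mulmxV // linearZ /=.
  by rewrite mxtrace1 => /esym/eqP; rewrite mulf_eq0 pnatr_eq0 (negbTE c0).
pose v := nz_row (kermx A); have v0 : v != 0 by rewrite nz_row_eq0.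
have vA : v *m A = 0 by apply/sub_kermxP; apply: nz_row_sub.
exists v => //; rewrite vA sub0mx /=.
have vBA : (v *m B <= kermx A)%MS.
  apply/sub_kermxP; rewrite -mulmxA.
  have -> : B *m A = A *m B - c *: A by rewrite -AB opprB addrC subrK.
  by rewrite mulmxBr mulmxA vA mul0mx -scalemxAr vA scaler0 subr0.
apply: submx_trans vBA _.
(* As [A] is nonzero, its kernel is the line spanned by [v]. *)
have rkA : (\rank (kermx A) <= \rank v)%N.
  rewrite mxrank_ker rank_rV v0 leq_subLR addn1 ltnS lt0n.
  by rewrite mxrank_eq0.
by have := mxrank_leqif_sup (nz_row_sub (kermx A)) => -[_ <-]; rewrite eqn_leq
   mxrankS ?nz_row_sub.
Qed.

(** * The Heisenberg case: $n=3$, $\lambda=-1$ *)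

Section Heisenberg.
Variables (C : numClosedFieldType).
Variables (L : vectType C) (br : {bilinear L -> L -> L}) (N : {vspace L}).
Variable f : 'Hom('rV[C]_3, L).
Hypotheses (leib : leibniz_identity br) (idN : ideal br N).
Hypotheses (solL : solvable_algebra br) (dimL : \dim {:L} = 5).
Hypotheses (kerf : lker f = 0%VS) (imf : limg f = N).
Hypothesis f_morph : forall u v, f (M2 3 (-1) u v) = br (f u) (f v).
Implicit Types (u v : 'rV[C]_3) (y z : L).

Local Notation D := (rmult br f).

(** The bracket is a 2 by 2 determinant times the central $e_3$, so $e_1,e_2$ can be replaced by any
    basis of their span once $e_3$ is rescaled by the determinant. *)
Lemma M2_heisenberg u v :
  M2 3 (-1) u v = (ecoef 2 u * ecoef 1 v - ecoef 1 u * ecoef 2 v) *: evec 3.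
Proof.
apply: ecoef_ext => k kn; rewrite ecoef_M2 // linearZ /= ecoef_evec //.
have -> : (1 < k <= 3 - 2)%N = false by lia.
by rewrite mulr0n add0r mulN1r mulNr mulr_natr.
Qed.

(* The action of [-, y] on N / [N, N], in the basis e_1, e_2. *)
Definition abmx y : 'M[C]_2 := \matrix_(i, j) ecoef j.+1 (D y (evec i.+1)).
Definition abrow u : 'rV[C]_2 := \row_j ecoef j.+1 u.

Lemma abrow_rmult y u : abrow (D y u) = abrow u *m abmx y.
Proof.
apply/rowP=> j; rewrite !mxE ecoef_lin !big_ord_recr !big_ord0 /= !mxE.
suff -> : ecoef j.+1 (D y (evec 3)) = 0 by rewrite mulr0 addr0.
rewrite -(M2_evecn (-1)) // (derivation_rmult leib idN kerf imf f_morph).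
rewrite !M2_heisenberg -scalerDl linearZ /= (@ecoef_evec _ _ _ 3) //.
by case: j => -[|[|]] //= _; rewrite mulr0.
Qed.

Lemma abmx_row y (i : 'I_2) : row i (abmx y) = abrow (D y (evec i.+1)).
Proof. by apply/rowP=> j; rewrite !mxE. Qed.

Lemma abmxP c y z : abmx (c *: y + z) = c *: abmx y + abmx z.
Proof.
apply/matrixP=> i j; rewrite !mxE (rmultP idN kerf imf).
by rewrite linearP.
Qed.

Lemma abmx_f u : abmx (f u) = 0.
Proof.
apply/matrixP=> i j; rewrite !mxE (rmult_f idN kerf imf f_morph) M2_heisenberg.
rewrite linearZ /= (@ecoef_evec _ _ _ 3) //.
by case: j => -[|[|]] //= _; rewrite mulr0.
Qed.

Lemma abmx_br y z : abmx (br y z) = abmx y *m abmx z - abmx z *m abmx y.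
Proof.
apply/row_matrixP=> i; rewrite linearB /= !row_mul !abmx_row -!abrow_rmult.
rewrite (rmult_br leib idN kerf imf); apply/rowP=> j; rewrite !mxE.
by rewrite linearB.
Qed.

(** By solvability $[L,L]+N$ has dimension at most 4, so it lies in a hyperplane [N + <[z]>]. *)
Lemma solvable_flag : exists y z, (N + <[z]> + <[y]>)%VS = fullv /\
  br z y \in (N + <[z]>)%VS.
Proof.
have dimN : \dim N = 3 := dim_N kerf imf.
have [] := solvable_derived2 idN solL (etrans dimL (congr1 (addn^~ 2) (esym dimN))).
set I := (_ + N)%VS => dimI _.
have ext (U : {vspace L}) w : w \notin U ->
    \dim (U + <[w]>) = (\dim U).+1.
  move=> wU; apply/eqP; rewrite eqn_leq; apply/andP; split.
    have [/leq_trans + _] := dimv_add_leqif U <[w]>; apply.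
    by rewrite dim_vline -addn1 leq_add2l; case: (_ != _).
  rewrite ltn_neqAle dimvS ?addvSl // andbT.
  have [_ ->] := dimv_leqif_sup (addvSl U <[w]>).
  apply: contra wU => /subvP; apply; apply: (subvP (addvSr _ _)).
  exact: memv_line.
have proper (U W : {vspace L}) : (\dim U < \dim W)%N -> exists2 w, w \in W & w \notin U.
  move=> UW; apply/subvPn; apply: contraL UW => /dimvS.
  by rewrite -leqNgt.
have [z zN IW] : exists2 z, z \notin N & (I <= N + <[z]>)%VS.
  have [IN|/subvPn[z zI zN]] := boolP (I <= N)%VS.
    have [|z _ zN] := proper N fullv; first by rewrite dimN dimL.
    by exists z => //; apply: subv_trans IN _; apply: addvSl.
  exists z => //; suff -> : (N + <[z]>)%VS = I by apply: subvv.
  apply/eqP; rewrite eqEdim subv_add addvSr /= -memvE zI /=.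
  by rewrite ext // -addn1.
have dimW : \dim (N + <[z]>) = 4 by rewrite ext ?dimN.
have [|y _ yW] := proper (N + <[z]>)%VS fullv; first by rewrite dimW dimL.
exists y, z; split.
  by apply/eqP; rewrite eqEdim subvf /= ext ?dimW ?dimL.
by apply/(subvP IW)/(subvP (addvSl _ _))/memv_brv; rewrite memvf.
Qed.

(** Elements of [N] act by 0 on $N/[N,N]$, so the matrices of [z] and [y] satisfy the hypothesis of
    [common_eigenvector_mx2], and all others are combinations of them. *)
Lemma common_eigenvector_abmx :
  exists2 w : 'rV[C]_2, w != 0 & forall y, exists a, w *m abmx y = a *: w.
Proof.
have [y [z [yz_full]]] := solvable_flag.
move=> /memv_addP[m1 /(memN imf)[u1 ->] [_ /vlineP[c ->] zy]].
have zyE : abmx z *m abmx y - abmx y *m abmx z = c *: abmx z.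
  by rewrite -abmx_br zy addrC abmxP abmx_f addr0.
have [w w0 /andP[/sub_rVP[a wz] /sub_rVP[b wy]]] := common_eigenvector_mx2 zyE.
exists w => // y'; have : y' \in (N + <[z]> + <[y]>)%VS by rewrite yz_full memvf.
move=> /memv_addP[_ /memv_addP[_ /(memN imf)[u ->] [_ /vlineP[s ->] ->]]].
move=> [_ /vlineP[t ->] ->]; exists (t * b + s * a).
rewrite addrC abmxP [f u + _]addrC abmxP abmx_f addr0 mulmxDr -!scalemxAr wz wy.
by rewrite !scalerA scalerDl.
Qed.

Lemma heisenberg_frame : exists f' : 'Hom('rV[C]_3, L),
  [/\ lker f' = 0%VS, limg f' = N,
      forall u v, f' (M2 3 (-1) u v) = br (f' u) (f' v)
    & forall y, ecoef 1 (rmult br f' y (evec 2)) = 0].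
Proof.
have [w w0 wP] := common_eigenvector_abmx.
(* The pair [(p, q)] completes [w] to a basis of the plane, with determinant [d]. *)
have [[p q] /= d0] : exists pq : C * C, w 0 1 * pq.1 - w 0 0 * pq.2 != 0.
  have [w1|w1] := eqVneq (w 0 1) 0; last first.
    by exists (1, 0); rewrite mulr1 mulr0 subr0.
  exists (0, 1); rewrite mulr0 mulr1 sub0r oppr_eq0; apply: contra_neq w0 => w00.
  apply/rowP=> -[[|[|//]] i2]; rewrite mxE; [rewrite -[RHS]w00|rewrite -[RHS]w1].
    by congr (w _ _); apply/val_inj.
  by congr (w _ _); apply/val_inj.
set d := _ - _ in d0.
(* The new $e_2$ is the common eigenvector; the factor [d] on $e_3$ ensures $[g_2,g_1]=g_3$. *)
pose g i : 'rV[C]_3 := if i == 1%N then p *: evec 1 + q *: evec 2 else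
  if i == 2 then w 0 0 *: evec 1 + w 0 1 *: evec 2 else d *: evec 3.
have gE : [/\ ecoef 1 (g 1%N) = p, ecoef 2 (g 1%N) = q & ecoef 3 (g 1%N) = 0] /\
    [/\ ecoef 1 (g 2%N) = w 0 0, ecoef 2 (g 2%N) = w 0 1 & ecoef 3 (g 2%N) = 0] /\
    [/\ ecoef 1 (g 3%N) = 0, ecoef 2 (g 3%N) = 0 & ecoef 3 (g 3%N) = d].
  by rewrite /g /=; do !split; rewrite ?linearD !linearZ /= !ecoef_evec //= 
    ?mulr0 ?mulr1 ?addr0 ?add0r.
have [[g11 g12 g13] [[g21 g22 g23] [g31 g32 g33]]] := gE.
have g3 : g 3 = d *: evec 3 by [].
clearbody g; clear gE.
have lin_free (s t : C) : s * p + t * w 0 0 = 0 -> s * q + t * w 0 1 = 0 ->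
    s = 0 /\ t = 0.
  move=> E1 E2; have sd : s * d = w 0 1 * (s * p + t * w 0 0) -
    w 0 0 * (s * q + t * w 0 1) by rewrite /d; ring.
  have td : t * d = p * (s * q + t * w 0 1) - q * (s * p + t * w 0 0).
    by rewrite /d; ring.
  rewrite E1 E2 !mulr0 subr0 in sd td.
  by move/eqP: sd; move/eqP: td; rewrite !mulf_eq0 (negbTE d0) !orbF => /eqP -> /eqP.
have dim3 : \dim {: 'rV[C]_3} = 3 by rewrite dimvf /dim /= mul1n.
have g_free (a : nat -> C) : \sum_(i < 3) a i.+1 *: g i.+1 = 0 ->
    forall i, (1 <= i <= 3)%N -> a i = 0.
  rewrite !big_ord_recl big_ord0 addr0 /= => a0.
  have := (congr1 (ecoef 1) a0, congr1 (ecoef 2) a0, congr1 (ecoef 3) a0).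
  rewrite !linear0 !linearD !linearZ /= g11 g12 g13 g21 g22 g23 g31 g32 g33.
  rewrite !mulr0 !addr0 !add0r => -[[/lin_free E /E[a1 a2]] /eqP].
  rewrite mulf_eq0 (negbTE d0) orbF => /eqP a3 i iN.
  by have [->|[->|->]] : i = 1%N \/ i = 2%N \/ i = 3%N by lia.
have gM i j : (1 <= i <= 3)%N -> (1 <= j <= 3)%N ->
    basis_map g (M2_table 3 3 (-1) i j) = M2 3 (-1) (g i) (g j).
  move=> iN jN; rewrite M2_heisenberg.
  have : i = 1%N \/ i = 2%N \/ i = 3%N by lia.
  have : j = 1%N \/ j = 2%N \/ j = 3%N by lia.
  case=> [->|[->|->]]; case=> [->|[->|->]];
  rewrite /M2_table /= ?linearZ ?linear0 /= ?basis_map_evec //;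
  rewrite ?g11 ?g12 ?g21 ?g22 ?g31 ?g32 ?g3 ?scalerA;
  try (by rewrite (_ : _ - _ = 0) ?scale0r //; ring);
  by congr (_ *: _); rewrite /d; ring.
have [kerP imP Pm] := basis_map_isomorphism dim3 g_free gM.
pose P : 'End('rV[C]_3) := linfun (basis_map g).
have fP_inj : lker (f \o P)%VF = 0%VS.
  by apply/eqP/lker0P => u v; rewrite !comp_lfunE => /(f_inj kerf)/(f_inj kerP).
exists (f \o P)%VF; split=> // [|u v|y].
- by rewrite limg_comp imP.
- by rewrite !comp_lfunE Pm f_morph.
have imfP : limg (f \o P)%VF = N by rewrite limg_comp imP.
set u := rmult _ _ _ _.
have Pu : P u = D y (P (evec 2)).
  apply: (f_inj kerf); rewrite (f_rmult idN imf).
  by have := f_rmult idN imfP y (evec 2); rewrite -/u !(comp_lfunE f P).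
have [a aE] := wP y.
have wE : abrow (P (evec 2)) = w.
  rewrite lfunE /= basis_map_evec //; apply/rowP=> -[[|[|//]] i2]; rewrite mxE /=.
    by rewrite g21; congr (w _ _); apply/val_inj.
  by rewrite g22; congr (w _ _); apply/val_inj.
(* Modulo $[N,N]$ the image of the new $e_2$ is a multiple of [w], so its coefficient on the new
   $e_1$ is 0. *)
have : abrow (P u) = a *: w by rewrite Pu abrow_rmult wE.
move=> /rowP aw; have := (aw 0, aw 1); rewrite !mxE /= lfunE /=.
rewrite /basis_map !big_ord_recl big_ord0 addr0 -!(ecoefS _ u) !linearD !linearZ /=.
rewrite g11 g12 g21 g22 g31 g32 !mulr0 !addr0 => -[E1 E2].
have [||//] := lin_free (ecoef 1 u) (ecoef 2 u - a).
- by rewrite mulrBl addrA E1 subrr.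
- by rewrite mulrBl addrA E2 subrr.
Qed.

End Heisenberg.

(** * Assembly of the triangular and Heisenberg cases *)

Theorem theorem3p10 (R : realType) (n : nat) (n_ge3 : (3 <= n)%N) :
  (forall (L : vectType R[i]) (br : {bilinear L -> L -> L}),
     leibniz_identity br -> solvable_algebra br -> \dim {:L} = (n + 2)%N ->
     (exists (lam : R[i]) (N : {vspace L}),
        nilradical br N /\ subalgebra_isomorphic (M2 n lam) br N) ->
     isomorphic (R20 R[i] n) br \/ isomorphic (R2m1 R[i] n) br) /\
  ~ isomorphic (R20 R[i] n) (R2m1 R[i] n).
Proof.
have char0 k : (k%:R == 0 :> R[i]) = (k == 0)%N := pnatr_eq0 _ k.
split; last exact: R20_not_isomorphic_R2m1.
move=> L br leib solL dimL [lam [N [radN [f [kerf imf fM]]]]].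
have idN : ideal br N by case: radN => -[].
have [/= n_lam|] := boolP ((4 <= n)%N || (lam != -1)).
  apply: (triangular_isomorphic n_ge3 char0 leib solL dimL radN kerf imf fM) => y.
  have derD := derivation_rmult leib idN kerf imf fM y.
  by apply: (derivation_off_diagonal n_ge3 _ derD n_lam); rewrite char0.
rewrite negb_or -ltnNge negbK => /andP[n3 /eqP lamE].
have nE : n = 3%N by apply/eqP; rewrite eqn_leq n_ge3 -ltnS n3.
subst n lam.
have [f' [kerf' imf' fM' off]] :=
  heisenberg_frame leib idN solL dimL kerf imf fM.
exact: (triangular_isomorphic n_ge3 char0 leib solL dimL radN kerf' imf' fM' off).
Qed.
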